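(* Let $n\ge 2$ be a fixed integer. For every positive integer $T\ge 2$ there is a set $\mathcal{E}_T$ of primes $p\le T$, depending only on $n$ and $T$, with $\#\mathcal{E}_T=o(T/\log T)$ as $T\to\infty$, such that the following holds. For every $\mathbf{e}=(e_1,\ldots,e_n)\in\mathbb{Z}^n$ with $e_1\cdots e_n\ne 0$ and every $\varepsilon>0$ there is a constant $C=C(n,\mathbf{e},\varepsilon)>0$ such that, for every sufficiently large $T$ and every prime $p\le T$ with $p\notin\mathcal{E}_T$, for all integers $h$ with $3\le h\le p$, all integers $k_1,\ldots,k_n$ with corresponding cube $\mathcal{B}=[k_1+1,k_1+h]\times\cdots\times[k_n+1,k_n+h]$, all complex-valued weights $\boldsymbol{\rho}=(\rho_1,\ldots,\rho_n)$ with $|\rho_j(x)|\le 1$ for all $x\in\mathbb{R}$ and $j=1,\ldots,n$, and all integers $\lambda$ with $\gcd(\lambda,p)=1$, we have $$ |S_p(\lambda,\boldsymbol{\rho},\mathbf{e};\mathcal{B})|\le C\left(h^{n/2}p^{1/2}+h^{n/2+\lceil n/2\rceil/2-1/4}\,p^{1/4}+h^{n-1/2}\right)h^{\varepsilon}. $$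
   Context: For a prime $p$ write $\mathbf{e}_p(z)=\exp(2\pi i z/p)$. The sum is $$ S_p(\lambda,\boldsymbol{\rho},\mathbf{e};\mathcal{B})=\sum_{\substack{(x_1,\ldots,x_n)\in\mathcal{B}\\ x_1\cdots x_n\not\equiv 0 \pmod p}}\rho_1(x_1)\cdots\rho_n(x_n)\,\mathbf{e}_p(\lambda x_1^{e_1}\cdots x_n^{e_n}), $$ where the summation is over integer vectors $(x_1,\ldots,x_n)$ in $\mathcal{B}$, and for a negative exponent $e$ the power $x^e$ is computed with the inverse of $x$ modulo $p$ (so $x_1^{e_1}\cdots x_n^{e_n}$ is a residue class modulo $p$). *)

(* Defs.v *)
From mathcomp Require Import all_boot all_order all_algebra finmap.
From mathcomp Require Import all_classical all_reals all_analysis.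
From mathcomp Require Import complex.

Set Implicit Arguments.
Unset Strict Implicit.
Unset Printing Implicit Defensive.

Import Order.TTheory GRing.Theory Num.Theory.
Import numFieldNormedType.Exports.

Local Open Scope classical_set_scope.
Local Open Scope ring_scope.
Local Open Scope complex_scope.

Definition ep (R : realType) (p : nat) (z : int) : R[i] :=
  let theta : R := 2 * pi * z%:~R / p%:R in cos theta +i* sin theta.

(* The residue class of lambda * x_1^(e_1) ... x_n^(e_n). For prime p the type
   'F_p is the field of integers modulo p, so that negative exponents refer to
   inverses modulo p as soon as p does not divide any x_j. *)
Definition monomial_mod (p n : nat) (lambda : int) (e : 'I_n -> int)
    (x : {ffun 'I_n -> int}) : 'F_p :=
  lambda%:~R * \prod_(j < n) ((x j)%:~R : 'F_p) ^ e j.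

Definition cube (n : nat) (k : 'I_n -> int) (h : nat) :
    set {ffun 'I_n -> int} :=
  [set x : {ffun 'I_n -> int} | forall j : 'I_n, k j + 1 <= x j <= k j + h%:Z].

(* ep has period p in z, hence can be evaluated on a residue class modulo p
   through its representative in {0, ..., p - 1}.
   The sum is a finitely supported one, and is meant for a finite set B (see
   cube_finite). *)
Definition Sp (R : realType) (p n : nat) (lambda : int)
    (rho : 'I_n -> R -> R[i]) (e : 'I_n -> int)
    (B : set {ffun 'I_n -> int}) : R[i] :=
  \sum_(x \in B `&` [set y : {ffun 'I_n -> int} |
                     ~~ (p%:Z %| \prod_(j < n) y j)%Z])
    (\prod_(j < n) rho j (x j)%:~R)
    * ep R p (nat_of_ord (monomial_mod p lambda e x))%:Z.

Lemma cube_finite (n : nat) (k : 'I_n -> int) (h : nat) :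
  finite_set (cube k h).
Proof.
pose f (i : {ffun 'I_n -> 'I_h}) : {ffun 'I_n -> int} :=
  [ffun j => k j + 1 + (i j : nat)%:Z].
apply: (@sub_finite_set _ _ (f @` setT)); last first.
  exact/finite_image/finite_finset.
move=> x xB.
pose d j := absz (x j - (k j + 1))%R.
have lt_h j : (d j < h)%N.
  have /andP[lo hi] := xB j.
  rewrite -ltz_nat /d gez0_abs ?subr_ge0// ltrBlDr addrA ltzD1.
  by rewrite addrC.
exists [ffun j => Ordinal (lt_h j)] => //.
apply/ffunP => j; rewrite !ffunE /=.
have /andP[lo _] := xB j.
by rewrite /d gez0_abs ?subr_ge0// addrC subrK.
Qed.

(* Main.v *)
Require Import Defs.
From mathcomp Require Import all_boot all_order all_algebra finmap.
From mathcomp Require Import all_classical all_reals all_analysis.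
From mathcomp Require Import complex.
From mathcomp Require Import all_fingroup cyclic all_field all_character.
From mathcomp Require Import zify ring lra.

(* Idea. Split the n variables into two blocks of m = n./2 and m = uphalf n
   variables. Cauchy-Schwarz and orthogonality of additive characters bound
   |S|^2 by p times the multiplicative energies of the two blocks; orthogonality
   of multiplicative characters and the AM-GM inequality replace each energy by
   the number J_m of solutions of
     (s + x_1)...(s + x_m) = (s + y_1)...(s + y_m) <> 0 in F_p,  0 <= x, y < h.
   For almost all primes J_m is at most (h^m + h^(2m) / sqrt (h p)) h^eps.
   After cancelling equal factors, a solution gives a nonzero polynomial
     P(X) = prod (X + x_i) - prod (X + y_i)
   with P(s) = 0 in F_p. Consider pairs (P, Q) of such polynomials.
   - If P and Q share a complex root z with integral minimal polynomial F, then
     F divides Q, so that prod F(- x_i) = prod F(- y_i), and the divisor bound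
     leaves h^(m + eps) possibilities for Q.
   - Otherwise p divides the nonzero resultant of P and Q, which is bounded by a
     power of h, so that only boundedly many primes p with p^2 > T can occur;
     this is negligible on average over p.
   Translating s by t < h gives h essentially equivalent instances of the
   problem, which gains the factor h that turns h^(2m) / sqrt p into
   h^(2m) / sqrt (h p). *)

Set Implicit Arguments.
Unset Strict Implicit.
Unset Printing Implicit Defensive.

Import Order.TTheory GRing.Theory Num.Theory.
Import numFieldNormedType.Exports.

(** * The divisor bound *)

(** From a + 1 <= k (a %/ k + 1) <= k 2 ^ (a %/ k), by raising to the k-th power. It serves twice:
    for small primes in the divisor bound, and for powers of log T. *)
Lemma exp_succ_le (k a : nat) : (0 < k)%N -> (a.+1 ^ k <= k ^ k * 2 ^ a)%N.
Proof.
move=> k0; apply: (@leq_trans ((k * 2 ^ (a %/ k)) ^ k)).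
  rewrite leq_exp2r //; apply: (@leq_trans (k * (a %/ k).+1)).
    by rewrite mulnC ltn_ceil.
  by rewrite leq_mul2l ltn_expl ?orbT.
by rewrite expnMn -expnM leq_mul2l leq_exp2l // leq_divM orbT.
Qed.

(** A divisor of p ^ a M is determined by its p-adic valuation, at most a, and its prime-to-p part,
    which divides M. *)
Lemma size_divisors_pfactor (p a M : nat) : prime p -> (0 < M)%N -> ~~ (p %| M)%N ->
  (size (divisors (p ^ a * M)) <= a.+1 * size (divisors M))%N.
Proof.
move=> pp M0 pM.
have N0 : (0 < p ^ a * M)%N by rewrite muln_gt0 expn_gt0 prime_gt0.
set s := [seq (p ^ b * d)%N | b <- iota 0 a.+1, d <- divisors M].
have -> : (a.+1 * size (divisors M))%N = size s by rewrite size_allpairs size_iota.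
apply: uniq_leq_size (divisors_uniq _) _ => d.
rewrite -dvdn_divisors // => dv.
have d0 : (0 < d)%N by apply: dvdn_gt0 dv.
apply/allpairsP; exists (logn p d, d`_p^')%N; rewrite -p_part partnC //.
split => //.
  rewrite mem_iota add0n ltnS /=; have /(dvdn_leq_log p N0) := dv.
  suff -> : logn p (p ^ a * M) = a by [].
  have pa0 : (0 < p ^ a)%N by rewrite expn_gt0 prime_gt0.
  rewrite lognM //; rewrite pfactorK //.
  by rewrite logn_coprime ?addn0 // prime_coprime.
rewrite -dvdn_divisors //.
have : (d`_p^' %| p ^ a * M)%N by apply: dvdn_trans dv; apply: dvdn_part.
rewrite Gauss_dvdr // coprime_sym coprimeXl //.
by rewrite (pnat_coprime _ (part_pnat _ _)) // pnat_id.
Qed.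

(** A prime power q ^ a contributes (a + 1) ^ k. For q >= 2 ^ k this is at most 2 ^ (a k) <= q ^ a,
    without loss; each of the finitely many smaller primes costs at most k ^ k by [exp_succ_le]. *)
Lemma divisors_pow_le (k : nat) : exists2 C : nat, (0 < C)%N &
  forall N : nat, (0 < N)%N -> (size (divisors N) ^ k <= C * N)%N.
Proof.
case: (posnP k) => [->|k0].
  by exists 1%N => // N N0; rewrite expn0 mul1n.
have K1 : (0 < k ^ k)%N by rewrite expn_gt0 k0.
(* Prime factors are allowed from 2 ^ k - t on: each step of the induction on t admits one more
   integer, and t = 2 ^ k removes the restriction. *)
suff H t N : (0 < N)%N -> (forall q, prime q -> (q %| N)%N -> (2 ^ k - t <= q)%N) ->
    (size (divisors N) ^ k <= (k ^ k) ^ t * N)%N.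
  exists ((k ^ k) ^ (2 ^ k))%N; first by rewrite expn_gt0 K1.
  by move=> N N0; apply: H => // q _ _; rewrite subnn.
elim: t N => [|t IH] N N0 big.
  rewrite expn0 mul1n.
  elim/ltn_ind: N N0 big => N IHN N0 big.
  have [->|N1] := eqVneq N 1%N; first by rewrite exp1n.
  have pp : prime (pdiv N) by apply: pdiv_prime; rewrite ltn_neqAle eq_sym N1.
  set p := pdiv N in pp.
  have p2k : (2 ^ k <= p)%N by have := big p pp (pdiv_dvd N); rewrite subn0.
  have [M pM eN] := pfactor_coprime pp N0.
  have M0 : (0 < M)%N by move: N0; rewrite eN muln_gt0 => /andP[].
  have a0 : (0 < logn p N)%N by rewrite logn_gt0 mem_primes pp N0 pdiv_dvd.
  set a := logn p N in eN a0.
  have MN : (M < N)%N.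
    by rewrite eN -[ltnLHS]muln1 ltn_mul2l M0 -(exp1n a) ltn_exp2r // prime_gt1.
  have {}pM : ~~ (p %| M)%N by rewrite -prime_coprime.
  have hM : (size (divisors M) ^ k <= M)%N.
    by apply: IHN => // q pq qM; apply: big => //; rewrite eN dvdn_mulr.
  rewrite eN mulnC.
  apply: leq_trans (_ : (a.+1 * size (divisors M)) ^ k <= _)%N.
    by rewrite leq_exp2r // size_divisors_pfactor.
  rewrite expnMn leq_mul //.
  apply: (@leq_trans ((2 ^ a) ^ k)); first by rewrite leq_exp2r // ltn_expl.
  by rewrite -expnM mulnC expnM leq_exp2r.
have [le2|lt2] := leqP (2 ^ k) t.
  apply: leq_trans (IH _ N0 _) _.
    by move=> q _ _; have /eqP -> : (2 ^ k - t == 0)%N by rewrite subn_eq0.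
  by rewrite leq_mul2r leq_pexp2l ?orbT.
have [pp|npp] := boolP (prime (2 ^ k - t.+1)); last first.
  apply: leq_trans (IH _ N0 _) _; last by rewrite leq_mul2r leq_pexp2l ?orbT.
  move=> q pq qN; have := big q pq qN; rewrite leq_eqVlt => /orP[/eqP eq|].
    by rewrite eq pq in npp.
  by rewrite -subSn // subSS.
set p := (2 ^ k - t.+1)%N in pp.
have [M pM eN] := pfactor_coprime pp N0.
have M0 : (0 < M)%N by move: N0; rewrite eN muln_gt0 => /andP[].
set a := logn p N in eN.
have {}pM : ~~ (p %| M)%N by rewrite -prime_coprime.
have hM : (size (divisors M) ^ k <= (k ^ k) ^ t * M)%N.
  apply: IH => // q pq qM.
  have := big q pq; rewrite eN dvdn_mulr // => /(_ isT).
  rewrite -/p leq_eqVlt => /orP[/eqP eq|]; first by rewrite eq qM in pM.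
  by rewrite /p -subSn // subSS.
rewrite eN mulnC.
apply: leq_trans (_ : (a.+1 * size (divisors M)) ^ k <= _)%N.
  by rewrite leq_exp2r // size_divisors_pfactor.
rewrite expnMn expnS -mulnA [(p ^ a * M)%N]mulnC [X in (_ <= _ * X)%N]mulnA mulnCA.
rewrite mulnC leq_mul //.
apply: leq_trans (exp_succ_le _ k0) _.
rewrite leq_mul2l; apply/orP; right.
by case: (a) => [//|b]; rewrite leq_exp2r // prime_gt1.
Qed.

(** * Differences of products of linear factors *)

Local Open Scope ring_scope.

Local Notation ZtoC := (map_poly (intr : int -> algC)).

Local Notation tpair m h := ({ffun 'I_m -> 'I_h} * {ffun 'I_m -> 'I_h})%type.

Definition shiftp (m h : nat) (x : {ffun 'I_m -> 'I_h}) : {poly int} :=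
  \prod_i ('X + (x i)%:R%:P).

Definition diffp (m h : nat) (u : tpair m h) :
  {poly int} := shiftp u.1 - shiftp u.2.

(** The situation after all equal factors have been cancelled. For m > 0 it forces [diffp u] to be
    nonzero, over the integers and, if h <= p, modulo p. *)
Definition disj (m h : nat) (u : tpair m h) :=
  [forall i, forall j, u.1 i != u.2 j].

Section Diffp.
Variables (m h : nat).
Implicit Types (x : {ffun 'I_m -> 'I_h}).
Implicit Types (u : tpair m h).

Lemma horner_shiftp (R : comNzRingType) x (a : R) :
  (map_poly intr (shiftp x)).[a] = \prod_i (a + (x i)%:R).
Proof.
rewrite rmorph_prod horner_prod; apply: eq_bigr => i _.
by rewrite rmorphD /= map_polyX map_polyC /= !hornerE -[X in a + X]mulrz_nat.
Qed.

Lemma horner_diffp (R : comNzRingType) u (a : R) :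
  (map_poly intr (diffp u)).[a] = \prod_i (a + (u.1 i)%:R) - \prod_i (a + (u.2 i)%:R).
Proof. by rewrite /diffp rmorphB /= hornerD hornerN !horner_shiftp. Qed.

Lemma horner_int_diffp u (a : int) :
  (diffp u).[a] = \prod_i (a + (u.1 i)%:R) - \prod_i (a + (u.2 i)%:R).
Proof.
by rewrite -horner_diffp map_poly_id // => z _; rewrite intz.
Qed.

Lemma size_shiftp x : size (shiftp x) = m.+1.
Proof.
have H i : 'X + (x i)%:R%:P = 'X - (- (x i)%:R)%:P :> {poly int}.
  by rewrite rmorphN opprK.
rewrite /shiftp (eq_bigr _ (fun i _ => H i)) size_prod_XsubC.
by rewrite -[index_enum _]enumT size_enum_ord.
Qed.

Lemma size_diffp u : (size (diffp u) <= m.+1)%N.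
Proof.
by apply: leq_trans (size_polyD _ _) _; rewrite size_polyN !size_shiftp maxnn.
Qed.

(** All coefficients are nonnegative, so each is at most the value at 1, a product of m factors 1 +
    x_i <= h. *)
Lemma coef_shiftp x i : 0 <= (shiftp x)`_i <= h%:R ^+ m.
Proof.
have ge0 j : 0 <= (shiftp x)`_j.
  move: j; apply: (big_ind (fun q : {poly int} => forall j, 0 <= q`_j)).
  - by move=> j; rewrite coef1; case: eqP.
  - by move=> p q hp hq j; rewrite coefM sumr_ge0 // => i' _; rewrite mulr_ge0.
  - by move=> k _ j; rewrite coefD coefX coefC; case: eqP; case: eqP.
rewrite ge0 /=.
have [im|mi] := leqP (size (shiftp x)) i.
  by rewrite nth_default // exprn_ge0.
apply: (@le_trans _ _ (shiftp x).[1]).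
  rewrite horner_coef (bigD1 (Ordinal mi)) //= expr1n mulr1 lerDl sumr_ge0 // => j _.
  by rewrite expr1n mulr1.
rewrite /shiftp horner_prod.
apply: le_trans (_ : \prod_(j < m) h%:R <= _); last by rewrite prodr_const card_ord.
by apply: ler_prod => j _; rewrite !hornerE -(natrD _ 1) ler0n ler_nat add1n ltn_ord.
Qed.

Lemma coef_diffp u i : `|(diffp u)`_i| <= h%:R ^+ m.
Proof.
rewrite coefB; have /andP[a1 a2] := coef_shiftp u.1 i.
by have /andP[b1 b2] := coef_shiftp u.2 i; rewrite ler_norml; apply/andP; split; lra.
Qed.

(** At - x_i the first product vanishes and the second is a product of differences y_j - x_i, all
    nonzero. *)
Lemma diffp_neq0_at u i : disj u -> (diffp u).[- (u.1 i)%:R] != 0.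
Proof.
move=> /forallP d; rewrite horner_int_diffp (bigD1 i) //= addNr mul0r sub0r oppr_eq0.
apply/prodf_neq0 => j _; rewrite addrC subr_eq0 eqr_nat eq_sym.
by have /forallP/(_ j) := d i.
Qed.

Lemma diffp_neq0_at2 u i : disj u -> (diffp u).[- (u.2 i)%:R] != 0.
Proof.
move=> /forallP d; rewrite horner_int_diffp [X in _ - X](bigD1 i) //= addNr mul0r subr0.
apply/prodf_neq0 => j _; rewrite addrC subr_eq0 eqr_nat.
by have /forallP/(_ i) := d j.
Qed.

Lemma diffp_neq0 u : (0 < m)%N -> disj u -> diffp u != 0.
Proof.
move=> m0 d; apply: contraNneq (diffp_neq0_at (Ordinal m0) d) => ->.
by rewrite horner0.
Qed.

End Diffp.

(** Cauchy's argument: the leading coefficient is a nonzero integer, so for |z| > 1 the equation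
    gives |z| ^ (s - 1) <= d B |z| ^ (s - 2), where s is the size of p. *)
Lemma root_norm_le (p : {poly int}) (d : nat) (B : int) (z : algC) :
  (0 < d)%N -> 1 <= B -> (size p <= d.+1)%N -> (forall i, `|p`_i| <= B) ->
  p != 0 -> root (ZtoC p) z -> `|z| <= (d%:R * B)%:~R.
Proof.
move=> d0 B1 sp cp p0 rz.
have dB1 : 1 <= d%:R * B.
  by rewrite -[leLHS]mulr1; apply: ler_pM => //; rewrite (ler_nat _ 1).
have [le1|lt1] := real_leP (normr_real z) (@real1 algC).
  by apply: le_trans le1 _; rewrite (ler_int _ 1).
set s := size p; have s1 : (0 < s)%N by rewrite size_poly_gt0.
have sC : size (ZtoC p) = s.-1.+1.
  by rewrite prednK // size_map_poly_id0 // intr_eq0 lead_coef_eq0.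
have e0 : (p`_s.-1)%:~R * z ^+ s.-1 = - \sum_(i < s.-1) (p`_i)%:~R * z ^+ i.
  move: rz; rewrite rootE horner_coef sC big_ord_recr /= addrC addr_eq0 coef_map /=.
  by move/eqP => ->; congr (- _); apply: eq_bigr => i _; rewrite coef_map.
have s2 : (0 < s.-1)%N.
  rewrite lt0n; apply/eqP => s0; move: e0; rewrite s0 big_ord0 oppr0 mulr1 => /eqP.
  by rewrite intr_eq0 -s0 -/(lead_coef p) lead_coef_eq0 (negPf p0).
have n0 : 0 < `|z| by apply: lt_trans lt1.
have nB i : `|(p`_i)%:~R : algC| <= B%:~R by rewrite -intr_norm ler_int.
have lc1 : 1 <= `|(p`_s.-1)%:~R : algC|.
  rewrite -intr_norm (ler_int _ 1) -gtz0_ge1 normr_gt0.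
  by rewrite -/(lead_coef p) lead_coef_eq0.
have : `|z| ^+ s.-1 <= (d%:R * B)%:~R * `|z| ^+ s.-2.
  apply: (@le_trans _ _ `|(p`_s.-1)%:~R * z ^+ s.-1|).
    by rewrite normrM normrX ler_peMl // exprn_ge0 // ltW.
  rewrite e0 normrN; apply: le_trans (ler_norm_sum _ _ _) _.
  apply: le_trans (_ : \sum_(i < s.-1) B%:~R * `|z| ^+ s.-2 <= _).
    apply: ler_sum => i _; rewrite normrM normrX; apply: ler_pM => //.
    by rewrite ler_weXn2l ?(ltW lt1) // -ltnS prednK.
  rewrite sumr_const card_ord -[X in X <= _]mulr_natl mulrA intrM.
  rewrite ler_wpM2r ?exprn_ge0 ?(ltW n0) // ler_wpM2r ?(le_trans _ (nB 0)) //.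
  by rewrite mulrz_nat ler_nat -ltnS prednK.
by rewrite -[in X in X -> _](prednK s2) exprS ler_pM2r // exprn_gt0.
Qed.

(** The complex roots of f are roots of p, bounded by [root_norm_le], and the leading coefficient of
    f divides that of p, hence is at most B in absolute value. *)
Lemma factor_horner_le (p f r : {poly int}) (d : nat) (B : int) (a : int) :
  (0 < d)%N -> 1 <= B -> (size p <= d.+1)%N -> (forall i, `|p`_i| <= B) ->
  p != 0 -> p = f * r -> `|f.[a]| <= B * (`|a| + d%:R * B) ^+ d.
Proof.
move=> d0 B1 sp cp p0 pfr.
have dB1 : 1 <= d%:R * B.
  by rewrite -[leLHS]mulr1; apply: ler_pM => //; rewrite (ler_nat _ 1).
have [f0 r0] : f != 0 /\ r != 0 by move: p0; rewrite pfr mulf_eq0 negb_or => /andP.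
have lcf : `|lead_coef f| <= B.
  apply: le_trans (cp (size p).-1); rewrite -/(lead_coef p) pfr lead_coefM normrM.
  by rewrite ler_peMr // -gtz0_ge1 normr_gt0 lead_coef_eq0.
have sf : (size f <= d.+1)%N.
  apply: leq_trans sp; rewrite pfr size_mul //.
  by rewrite -subn1 -addnBA ?size_poly_gt0 // leq_addr.
have inj : injective (intr : int -> algC) by apply: intr_inj.
have [rs E] := closed_field_poly_normal (ZtoC f).
have lE : lead_coef (ZtoC f) = (lead_coef f)%:~R by rewrite lead_coef_map_inj.
have srs : (size rs <= d)%N.
  have := congr1 (fun q : {poly algC} => size q) E; rewrite size_scale; last first.
    by rewrite lE intr_eq0 lead_coef_eq0.
  by rewrite size_prod_XsubC size_map_inj_poly // => es; rewrite es in sf.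
rewrite -(ler_int algC) intr_norm -horner_map E hornerZ normrM lE rmorphM /=.
apply: ler_pM => //; first by rewrite -intr_norm ler_int.
rewrite horner_prod normr_prod rmorphXn rmorphD /=.
set M := _ + _.
have M1 : 1 <= M.
  by rewrite /M -rmorphD /= (ler_int _ 1) (le_trans dB1) // lerDr.
apply: (@le_trans _ _ (M ^+ size rs)); last by rewrite ler_weXn2l.
have : all (root (ZtoC p)) rs.
  apply/allP => z zr; rewrite pfr rmorphM /= rootM E rootZ ?root_prod_XsubC ?zr //.
  by rewrite lE intr_eq0 lead_coef_eq0.
move: M1; clear - d0 B1 sp cp p0.
move=> M1; elim: rs => [|z rs IH] /=; first by rewrite big_nil.
case/andP => rz rrs; rewrite big_cons exprS; apply: ler_pM => //; last exact: IH.
  by rewrite prodr_ge0.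
rewrite hornerXsubC; apply: le_trans (ler_normB _ _) _.
by rewrite /M -intr_norm lerD2l (root_norm_le d0 B1 sp).
Qed.

(** F is the primitive integral multiple of the minimal polynomial of z over the rationals; by
    Gauss's lemma, divisibility by F over the rationals implies divisibility over the integers. *)
Lemma int_minpoly (z : algC) :
  exists2 F : {poly int}, (1 < size F)%N &
    forall q : {poly int}, root (ZtoC q) z -> exists r, q = F * r.
Proof.
have [P [eP mP hP]] := minCpolyP z.
have [q [a a0 eq]] := rat_poly_scale P.
have comp (g : {poly int}) : ZtoC g = map_poly ratr (map_poly (intr : int -> rat) g).
  by rewrite -map_poly_comp; apply: eq_map_poly => x /=; rewrite ratr_int.
have sP : (1 < size P)%N by have := size_minCpoly z; rewrite eP size_map_poly.
have szq : size q = size P.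
  by rewrite eq size_scale ?invr_eq0 ?intr_eq0 // size_rat_int_poly.
exists (zprimitive q); first by rewrite size_zprimitive szq.
move=> g; rewrite comp hP eq dvdpZl ?invr_eq0 ?intr_eq0 // dvdp_rat_int.
by case/dvdpP_int => r ->; exists r.
Qed.

(** * Elementary counting *)

Lemma leq_card_inj (T T' : finType) (A : {pred T}) (B : {pred T'}) (f : T -> T') :
  {in A &, injective f} -> {in A, forall x, f x \in B} -> (#|A| <= #|B|)%N.
Proof.
move=> inj AB; rewrite -(card_in_imset inj); apply: subset_leq_card.
by apply/fintype.subsetP => _ /imsetP[x xA ->]; apply: AB.
Qed.

Lemma card_has_le (T : finType) (I : Type) (s : seq I) (Q : I -> pred T) (K : nat) :
  (forall i, (#|Q i| <= K)%N) ->
  (#|[pred a | has (Q^~ a) s]| <= size s * K)%N.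
Proof.
move=> H; elim: s => [|d s IH].
  by rewrite eq_card0 // => a; rewrite inE.
rewrite mulSn; apply: leq_trans (leq_add (H d) IH).
rewrite -cardUI; apply: leq_trans (leq_addr _ _).
by apply: subset_leq_card; apply/fintype.subsetP => a; rewrite !inE.
Qed.

Lemma card_fiber_le (T T' : finType) (A : {pred T}) (f : T -> T') (K : nat) :
  (forall d, (#|[pred a in A | f a == d]| <= K)%N) -> (#|A| <= #|T'| * K)%N.
Proof.
move=> H; rewrite [#|T'|]cardE.
apply: leq_trans (card_has_le (Q := fun d => [pred a in A | f a == d]) (enum T') H).
apply: subset_leq_card; apply/fintype.subsetP => a aA; rewrite inE.
by apply/hasP; exists (f a); rewrite ?mem_enum // inE eqxx andbT.
Qed.

(** K is the integer part of the k-th root of X. Factors h ^ eps are encoded in [nat] as bounds on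
    k-th powers; these cannot be added directly, whereas bounds by K can. *)
Lemma ex_root_floor (k X : nat) : (0 < k)%N ->
  exists2 K, (K ^ k <= X)%N & forall i, (i ^ k <= X)%N -> (i <= K)%N.
Proof.
move=> k0.
have ub i : (i ^ k <= X)%N -> (i <= X)%N.
  by apply: leq_trans; case: (i) => // n; rewrite -[leqLHS]expn1 leq_pexp2l.
have ex0 : exists i, (i ^ k <= X)%N by exists 0%N; rewrite exp0n.
by have [K KX Kmax] := ex_maxnP ex0 ub; exists K.
Qed.

(** * Tuples with a common factor *)

Section Count.
Variables (m h : nat).
Implicit Types (u : tpair m h).

(* Each root z of F satisfies prod (z + x_i) = prod (z + y_i). *)
Lemma prod_horner_factor (F r : {poly int}) u : diffp u = F * r ->
  \prod_i F.[- (u.1 i)%:R] = \prod_i F.[- (u.2 i)%:R].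
Proof.
move=> E; have [F0|F0] := eqVneq F 0.
  by rewrite F0; apply: eq_bigr => i _; rewrite !horner0.
have lF : lead_coef (ZtoC F) = (lead_coef F)%:~R by rewrite lead_coef_map_inj //; apply: intr_inj.
have [rs EF] := closed_field_poly_normal (ZtoC F).
have H (x : {ffun 'I_m -> 'I_h}) : ((\prod_i F.[- (x i)%:R])%:~R : algC) =
    \prod_(i < m) (lead_coef F)%:~R * \prod_(z <- rs) \prod_i - (z + (x i)%:R).
  rewrite rmorph_prod exchange_big -big_split; apply: eq_bigr => i _ /=.
  rewrite -horner_map /= EF lF hornerZ horner_prod rmorphN /= mulrz_nat.
  by congr (_ * _); apply: eq_bigr => z _; rewrite hornerXsubC opprD addrC.
apply: (@intr_inj algC); rewrite !H; congr (_ * _).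
rewrite big_seq [RHS]big_seq; apply: eq_bigr => z zr.
rewrite !prodrN; congr (_ * _); apply/eqP; rewrite -subr_eq0 -horner_diffp -rootE.
rewrite E rmorphM /= rootM EF rootZ ?root_prod_XsubC ?zr //.
by rewrite lF intr_eq0 lead_coef_eq0.
Qed.

(** The condition says that - a is a root of F ^ 2 - d ^ 2, which is nonzero because F is not
    constant, and has degree at most 2 m. *)
Lemma card_abs_horner (F : {poly int}) (d : nat) : (1 < size F <= m.+1)%N ->
  (#|[pred a : 'I_h | `|F.[- (a : nat)%:R]|%N == d]| <= 2 * m)%N.
Proof.
move=> /andP[F1 Fm].
have s2 : size (F ^+ 2 - (d%:Z ^+ 2)%:P) = (size F).-1.*2.+1.
  have sF : size (F ^+ 2) = (size F).-1.*2.+1.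
    have F0 : F != 0 by rewrite -size_poly_gt0 ltnW.
    rewrite expr2 size_mul // -addnn; case: (size F) F1 => // n _.
    by rewrite /= addnS.
  rewrite size_polyDl sF // size_polyN (leq_ltn_trans (size_polyC_leq1 _)) //.
  by rewrite ltnS double_gt0 -ltnS prednK // ltnW.
have nz : F ^+ 2 - (d%:Z ^+ 2)%:P != 0 by rewrite -size_poly_gt0 s2.
set A := [pred a | _].
have inj : injective (fun a : 'I_h => - (a : nat)%:R : int).
  by move=> a b /oppr_inj/eqP; rewrite eqr_nat => /eqP/val_inj.
have := max_poly_roots nz (rs := map (fun a : 'I_h => - (a : nat)%:R : int) (enum A)).
rewrite size_map -cardE s2 ltnS => H; apply: leq_trans (H _ _) _.
- apply/allP => x /mapP[a]; rewrite mem_enum inE => /eqP e ->.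
  by rewrite rootE !hornerE -e abszE real_normK ?num_real // subrr.
- by rewrite map_inj_uniq ?enum_uniq.
by rewrite -mul2n leq_mul2l /= -ltnS prednK // ltnW.
Qed.

(** Each F(- x_i) divides N, so its absolute value is a divisor of N, and each divisor is attained
    by at most 2 m values of x_i. *)
Lemma card_common_factor_fiber (F : {poly int}) (N : nat) :
  (0 < m)%N -> (1 < size F <= m.+1)%N -> (0 < N)%N ->
  (#|[pred x : {ffun 'I_m -> 'I_h} |
      absz (\prod_i F.[- (nat_of_ord (x i))%:R])%R == N]|
     <= (size (divisors N) * (2 * m)) ^ m)%N.
Proof.
move=> m0 sF N0.
have := card_has_le (divisors N) (fun d => card_abs_horner d sF).
set A := [pred a | _] => hA.
pose G : {pred {ffun 'I_m -> 'I_h}} := ffun_on A.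
have hc : #|G| = (#|A| ^ m)%N by rewrite card_ffun_on card_ord.
apply: (@leq_trans (#|A| ^ m)); last by rewrite leq_exp2r.
rewrite -hc.
apply: subset_leq_card; apply/fintype.subsetP => x; rewrite inE => /eqP e.
apply/ffun_onP => i; rewrite inE; apply/hasP; exists (absz F.[- (nat_of_ord (x i))%:R]); last first.
  by rewrite inE.
by rewrite -dvdn_divisors // -e (bigD1 i) //= abszM dvdn_mulr.
Qed.

End Count.

(** With F from [int_minpoly], each such v = (x, y) satisfies prod F(- x_i) = prod F(- y_i). For
    fixed y this is a nonzero number bounded by a power of h, so the divisor bound leaves few x; y
    itself has at most h ^ m values. The k-th power expresses a loss of h ^ (1 / k). *)
Lemma card_common_root (m k : nat) : (0 < m)%N -> (0 < k)%N ->
  exists C : nat, forall (h : nat) (z : algC), (0 < h)%N ->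
  (#|[pred v : tpair m h |
      disj v && root (ZtoC (diffp v)) z]| ^ k <= C * h ^ (m * k + 1))%N.
Proof.
move=> m0 k0.
(* The m factors F(- y_i) have product N <= A h ^ D, with A = (m + 1) ^ (m ^ 2). The divisor bound
   for the power m k D, after a D-th root, bounds the m k-th power of the number of divisors of N by
   C0 A h. *)
pose D := (m * (m + m * m))%N.
have D0 : (0 < D)%N by rewrite muln_gt0 m0 addn_gt0 m0.
have [C0 C0p HC] := divisors_pow_le (m * k * D).
pose A := (m.+1 ^ (m * m))%N.
have A0 : (0 < A)%N by rewrite expn_gt0.
exists (C0 * A * (2 * m) ^ (m * k))%N => h z h0.
have [F F1 hF] := int_minpoly z.
set S := [pred v | _].
pose fib y := #|[pred v in S | v.2 == y]|.
have fibk y : (fib y ^ k <= C0 * A * (2 * m) ^ (m * k) * h)%N.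
  have [/eqP fz|] := boolP (fib y == 0)%N; first by rewrite fz exp0n.
  rewrite -lt0n => /card_gt0P[v]; rewrite !inE => /andP[/andP[dv rv] /eqP vy].
  have [r Er] := hF _ rv.
  have v0 : diffp v != 0 by apply: diffp_neq0.
  have [F0 r0] : F != 0 /\ r != 0 by move: v0; rewrite Er mulf_eq0 negb_or => /andP.
  have sF : (1 < size F <= m.+1)%N.
    rewrite F1 (leq_trans _ (size_diffp v)) // Er size_mul //.
    by rewrite -subn1 -addnBA ?size_poly_gt0 // leq_addr.
  set N := absz (\prod_i F.[- (nat_of_ord (y i))%:R]).
  have N0 : (0 < N)%N.
    rewrite absz_gt0; apply/prodf_neq0 => i _.
    apply: contraNneq (diffp_neq0_at2 i dv) => e.
    by rewrite Er hornerM vy e mul0r.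
  have NB : (N <= A * h ^ D)%N.
    have hm1 : 1 <= (h%:R : int) ^+ m by rewrite exprn_ege1 // (ler_nat _ 1).
    have bnd a : (a < h)%N -> (absz (F.[- a%:R]) <= m.+1 ^ m * h ^ (m + m * m))%N.
      move=> ah; rewrite -lez_nat abszE.
      apply: le_trans (factor_horner_le _ m0 hm1 (size_diffp v) (coef_diffp v) v0 Er) _.
      have -> : Posz (m.+1 ^ m * h ^ (m + m * m)) = h%:R ^+ m * (m.+1%:R * h%:R ^+ m) ^+ m.
        by rewrite -natz natrM !natrX exprD exprMn -exprM mulrCA.
      rewrite normrN normr_nat.
      rewrite ler_wpM2l ?exprn_ge0 // lerXn2r ?nnegrE ?addr_ge0 ?mulr_ge0 ?exprn_ge0 //.
      rewrite -natr1 mulrDl mul1r addrC lerD2l.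
      apply: le_trans (_ : h%:R <= _); first by rewrite ler_nat ltnW.
      by rewrite -[leLHS]expr1 ler_weXn2l // (ler_nat _ 1).
    rewrite /N (big_morph absz abszM (erefl _)).
    apply: (@leq_trans (\prod_(i < m) (m.+1 ^ m * h ^ (m + m * m)))%N).
      by apply: leq_prod => i _; apply: bnd.
    by rewrite prod_nat_const card_ord expnMn -!expnM /A /D [(m * (m + _))%N]mulnC.
  have fle : (fib y <= (size (divisors N) * (2 * m)) ^ m)%N.
    apply: leq_trans (card_common_factor_fiber h m0 sF N0).
    apply: (leq_card_inj (f := fst)).
      by move=> [a b] [c d]; rewrite !inE /= => /andP[_ /eqP e1]
      /andP[_ /eqP e2] e3; rewrite e1 e2 e3.
    move=> [a b]; rewrite !inE /= => /andP[/andP[_ rw] /eqP e].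
    have [r' Er'] := hF _ rw.
    by have /= -> := prod_horner_factor Er'; rewrite e.
  have tau : (size (divisors N) ^ (m * k) <= C0 * A * h)%N.
    rewrite -(leq_exp2r _ _ D0) -expnM.
    apply: leq_trans (HC N N0) _; rewrite -mulnA !expnMn.
    rewrite leq_mul //; first by rewrite -[leqLHS]expn1 leq_pexp2l.
    by apply: leq_trans NB _; rewrite leq_mul // -[leqLHS]expn1 leq_pexp2l.
  apply: leq_trans (_ : ((size (divisors N) * (2 * m)) ^ m) ^ k <= _)%N.
    by rewrite leq_exp2r.
  by rewrite -expnM expnMn mulnAC leq_mul.
have := @card_fiber_le _ _ S snd (\max_y fib y) (fun y => leq_bigmax y).
rewrite card_ffun !card_ord => H.
apply: leq_trans (_ : (h ^ m * \max_y fib y) ^ k <= _)%N; first by rewrite leq_exp2r.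
rewrite expnMn -expnM addn1 expnSr [X in (_ <= X)%N]mulnCA leq_mul2l; apply/orP; right.
by apply: (big_ind (fun n => (n ^ k <= C0 * A * (2 * m) ^ (m * k) * h)%N));
  [rewrite exp0n | move=> a b ha hb; rewrite /maxn; case: ifP |].
Qed.

Definition copair (m h : nat) (u v : tpair m h) :=
  coprimep (ZtoC (diffp u)) (ZtoC (diffp v)).

(** A pair that is not coprime shares one of the at most m complex roots of [diffp u];
    [card_common_root] applies to each of them. *)
Lemma card_noncoprime (m k : nat) : (0 < m)%N -> (0 < k)%N ->
  exists C : nat, forall (h : nat) (u : tpair m h),
    (0 < h)%N -> disj u ->
  (#|[pred v | disj v && ~~ copair u v]| ^ k <= C * h ^ (m * k + 1))%N.
Proof.
move=> m0 k0; have [C HC] := card_common_root m0 k0.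
exists (m ^ k * C)%N => h u h0 du.
have u0 : diffp u != 0 by apply: diffp_neq0.
have [rs E] := closed_field_poly_normal (ZtoC (diffp u)).
have inj : injective (intr : int -> algC) by apply: intr_inj.
have lE : lead_coef (ZtoC (diffp u)) != 0.
  by rewrite lead_coef_map_inj // intr_eq0 lead_coef_eq0.
have srs : (size rs <= m)%N.
  have := size_diffp u; rewrite -(size_map_inj_poly inj) // E size_scale //.
  by rewrite size_prod_XsubC.
pose Q z := [pred v : tpair m h |
  disj v && root (ZtoC (diffp v)) z].
set X := (C * h ^ (m * k + 1))%N.
have [K KX Kmax] := ex_root_floor X k0.
have QK z : (#|Q z| <= K)%N by apply/Kmax/HC.
rewrite -mulnA -/X; apply: (@leq_trans ((m * K) ^ k)%N); last by rewrite expnMn leq_mul2l KX orbT.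
rewrite leq_exp2r //.
apply: (@leq_trans (size rs * K)%N); last by rewrite leq_mul2r srs orbT.
apply: leq_trans (card_has_le rs QK); apply: subset_leq_card.
apply/fintype.subsetP => v; rewrite !inE => /andP[dv nc]; apply/hasP.
have [z rz rvz] : exists2 z, root (ZtoC (diffp u)) z & root (ZtoC (diffp v)) z.
  apply: contrapT => H; move/negP: nc; apply; apply/Pdiv.ClosedField.coprimepP => z rz.
  by apply/negP => rvz; apply: H; exists z.
exists z; last by rewrite inE dv.
by move: rz; rewrite E rootZ // root_prod_XsubC.
Qed.

(** * Pairs without a common complex root *)

Lemma det_norm_le (n : nat) (A : 'M[int]_n) (B : int) :
  (forall i j, `|A i j| <= B) -> `|\det A| <= n`!%:R * B ^+ n.
Proof.
move=> hA; rewrite /determinant; apply: le_trans (ler_norm_sum _ _ _) _.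
apply: (@le_trans _ _ (\sum_(s : {perm 'I_n}) B ^+ n)); last first.
  by rewrite sumr_const card_Sn mulr_natl.
apply: ler_sum => s _; rewrite normrM normrX normrN1 expr1n mul1r normr_prod.
apply: (@le_trans _ _ (\prod_(i < n) B)); first by apply: ler_prod => i _; rewrite normr_ge0 hA.
by rewrite prodr_const card_ord.
Qed.

Lemma resultant_norm_le (p q : {poly int}) (B : int) : 0 <= B ->
  (forall i, `|p`_i| <= B) -> (forall i, `|q`_i| <= B) ->
  `|resultant p q| <= ((size q).-1 + (size p).-1)`!%:R * B ^+ ((size q).-1 + (size p).-1).
Proof.
move=> B0 hp hq; apply: det_norm_le => i j.
rewrite Sylvester_mxE /=.
case: (fintype.split i) => k; case: (_ <= _)%N; rewrite ?mulr1n ?mulr0n ?normr0 //.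
Qed.

Section Res.
Variables (m h : nat).
Implicit Types (u v : tpair m h).

(** The identity [resultant_in_ideal] concerns nonconstant polynomials. If one of the two is
    constant, that constant replaces the resultant: it too vanishes modulo p when there is a common
    root. *)
Definition resp u v : int :=
  if (size (diffp u) <= 1)%N then (diffp u)`_0
  else if (size (diffp v) <= 1)%N then (diffp v)`_0
  else resultant (diffp u) (diffp v).

Lemma size_le1_nz (p : {poly int}) : (size p <= 1)%N -> p != 0 -> p`_0 != 0.
Proof. by move/size1_polyC => e; rewrite {1}e polyC_eq0. Qed.

(** A zero resultant means a nonconstant gcd over the integers, any complex root of which is a
    common root. *)
Lemma resp_neq0 u v : (0 < m)%N -> disj u -> disj v -> copair u v -> resp u v != 0.
Proof.
move=> m0 du dv cuv; have u0 := diffp_neq0 m0 du; have v0 := diffp_neq0 m0 dv.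
rewrite /resp; case: ifP => [s1|_]; first exact: size_le1_nz.
case: ifP => [s1|_]; first exact: size_le1_nz.
rewrite resultant_eq0; apply/negP => s1.
set g := gcdp _ _ in s1 *.
have [z rz] : exists z, root (ZtoC g) z.
  apply/closed_rootP; rewrite size_map_inj_poly //; last exact: intr_inj.
  by rewrite gtn_eqF.
have rd w : (g %| diffp w)%R -> root (ZtoC (diffp w)) z.
  case/Pdiv.Idomain.dvdpP => -[c r] /= c0 /(congr1 ZtoC).
  rewrite map_polyZ rmorphM /= => /(congr1 (root^~ z)).
  by rewrite rootM rz orbT rootZ ?intr_eq0.
have H := coprimep_root cuv.
have /H : root (ZtoC (diffp u)) z by apply: rd; apply: dvdp_gcdl.
by rewrite -rootE rd // dvdp_gcdr.
Qed.

(** The resultant is a combination of the two polynomials with coefficients in Z[X], so it can be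
    evaluated at a common root in any commutative ring. *)
Lemma resp_root (F : comNzRingType) u v (s : F) :
  root (map_poly intr (diffp u)) s -> root (map_poly intr (diffp v)) s ->
  (resp u v)%:~R = 0 :> F.
Proof.
have C (p : {poly int}) : (size p <= 1)%N -> root (map_poly intr p) s -> (p`_0)%:~R = 0 :> F.
  by move/size1_polyC => e; rewrite {1}e map_polyC /= rootC => /eqP.
rewrite /resp; case: ifP => [s1 ru _|]; first exact: C.
case: ifP => [s1 _ _ rv|]; first exact: C.
move=> /negbT sv /negbT su /eqP ru /eqP rv; rewrite -!ltnNge in sv su.
have [[a b] _ E] := resultant_in_ideal su sv.
have := congr1 (fun g => (map_poly intr g : {poly F}).[s]) E.
by rewrite map_polyC hornerC /= rmorphD !rmorphM /= hornerD !hornerM ru rv !mulr0 addr0.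
Qed.

Lemma resp_le u v : (0 < h)%N ->
  (absz (resp u v) <= (m + m)`! * h ^ (m * (m + m) + m))%N.
Proof.
move=> h0.
have f1 : (0 < (m + m)`!)%N by apply: fact_gt0.
have hh : (h ^ m <= (m + m)`! * h ^ (m * (m + m) + m))%N.
  by rewrite -[leqLHS]mul1n leq_mul // leq_pexp2l // leq_addl.
have cu (w : tpair m h) i : (absz ((diffp w)`_i)%R <= h ^ m)%N.
  by have := @coef_diffp m h w i; rewrite -natrX natz -abszE lez_nat.
rewrite /resp; case: ifP => [_|_]; first exact: leq_trans (cu _ _) hh.
case: ifP => [_|_]; first exact: leq_trans (cu _ _) hh.
have B0 : 0 <= (h%:R : int) ^+ m by rewrite exprn_ge0.
have := resultant_norm_le B0 (coef_diffp u) (coef_diffp v).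
set n := (_ + _)%N.
have nm : (n <= m + m)%N.
  by rewrite leq_add // -subn1 leq_subLR add1n size_diffp.
rewrite -!natrX -natrM natz -abszE lez_nat => H; apply: leq_trans H _.
rewrite leq_mul ?leq_fact //.
by rewrite -expnM leq_pexp2l // (leq_trans _ (leq_addr _ _)) // leq_mul2l nm orbT.
Qed.

End Res.

Lemma natr_Fp_inj (p a b : nat) : prime p -> (a < p)%N -> (b < p)%N ->
  a%:R = b%:R :> 'F_p -> a = b.
Proof.
move=> pp ap bp /(congr1 (@nat_of_ord _)).
by rewrite !val_Fp_nat // !modn_small.
Qed.

(** As h <= p, distinct entries stay distinct modulo p, so the value at - x_i is still nonzero. *)
Lemma diffp_Fp_neq0 (m h p : nat) (u : tpair m h) :
  prime p -> (h <= p)%N -> (0 < m)%N -> disj u ->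
  map_poly intr (diffp u) != 0 :> {poly 'F_p}.
Proof.
move=> pp hp m0 /forallP d; pose i := Ordinal m0.
apply/eqP => /(congr1 (fun g : {poly 'F_p} => g.[- (u.1 i)%:R])).
rewrite horner_diffp horner0 (bigD1 i) //= addNr mul0r sub0r => /eqP.
rewrite oppr_eq0; apply/negP/prodf_neq0 => j _; rewrite addrC subr_eq0.
apply/eqP => /natr_Fp_inj e; have /forallP/(_ j)/eqP := d i; apply; apply/val_inj => /=.
by rewrite e // (leq_trans (ltn_ord _)).
Qed.

(** The product of these distinct primes divides N, whence T ^ (size s) <= (prod p) ^ 2 <= N ^ 2 <=
    T ^ (2 K). *)
Lemma size_primes_dvd (s : seq nat) (N T K : nat) : (1 < T)%N -> (0 < N)%N ->
  uniq s -> (forall p, p \in s -> [/\ prime p, (T < p ^ 2)%N & (p %| N)%N]) ->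
  (N <= T ^ K)%N -> (size s <= 2 * K)%N.
Proof.
move=> T1 N0 us hs NT.
have : (\prod_(p <- s) p %| N)%N.
  move: us hs; clear NT; elim: s => [|p s IH] /=; first by rewrite big_nil.
  move=> /andP[ps us] hs; rewrite big_cons Gauss_dvd.
    have [_ _ ->] := hs p (mem_head _ _); apply: IH => // q qs.
    by apply: hs; rewrite inE qs orbT.
  have [pp _ _] := hs p (mem_head _ _).
  rewrite big_seq; apply: (big_ind (fun q => coprime p q)).
  - exact: coprimen1.
  - by move=> a b; rewrite coprimeMr => -> ->.
  move=> q qs; rewrite prime_coprime // dvdn_prime2 //.
    by apply: contraNneq ps => ->.
  by have [] := hs q; rewrite ?inE ?qs ?orbT.
move=> /(dvdn_leq N0) le.
rewrite -(leq_exp2l _ _ T1) mulnC expnM.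
apply: leq_trans (_ : (\prod_(p <- s) p) ^ 2 <= _)%N; last first.
  by rewrite leq_exp2r // (leq_trans le).
move: hs; clear; elim: s => [|p s IH] hs; first by rewrite big_nil.
rewrite big_cons /= expnS expnMn leq_mul //.
  by have [_ /ltnW] := hs p (mem_head _ _).
by apply: IH => q qs; apply: hs; rewrite inE qs orbT.
Qed.

(** * Solutions modulo p *)

Definition sols (m h p : nat) (s : 'F_p) :
    pred (tpair m h) :=
  [pred u : tpair m h | (\prod_i (s + (u.1 i)%:R) == \prod_i (s + (u.2 i)%:R)) &&
            (\prod_i (s + (u.1 i)%:R) != 0)].

Definition dsols (m h p : nat) (s : 'F_p) :
    pred (tpair m h) :=
  [pred u : tpair m h | sols s u && disj u].

Definition dcopair (m h : nat) : pred (tpair m h * tpair m h) :=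
  [pred w : tpair m h * tpair m h | [&& disj w.1, disj w.2 & copair w.1 w.2]].

Definition comroot (m h p : nat) (w : tpair m h * tpair m h) : pred 'F_p :=
  [pred s | root (map_poly intr (diffp w.1)) s && root (map_poly intr (diffp w.2)) s].

(* Triples (u, v, s): if the total over all s is small, the shift by t < h makes
   it small for every single s, with a gain of h (see ncom_ge). *)
Definition ncom (m h p : nat) : nat :=
  (\sum_(w | @dcopair m h w) #|@comroot m h p w|)%N.

Lemma card_sum_pair (S T : finType) (P : pred S) (Q : S -> pred T) :
  (\sum_(x | P x) #|Q x| = #|[pred w : S * T | P w.1 && Q w.1 w.2]|)%N.
Proof.
rewrite -sum1_card -(pair_big_dep P Q (fun _ _ => 1%N)).
by apply: eq_bigr => x _; rewrite sum1_card.
Qed.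

Lemma intr_Fp_eq0 (p : nat) (z : int) : prime p ->
  z%:~R = 0 :> 'F_p -> (p %| absz z)%N.
Proof.
by move=> pp /eqP; rewrite -(dvdz_pcharf (pchar_Fp pp)) dvdzE.
Qed.

(** A common root forces p to divide [resp], and there are at most m of them since [diffp w.1] stays
    nonzero modulo p. *)
Lemma card_comroot (m h p : nat) w : prime p -> (h <= p)%N -> (0 < m)%N ->
  @dcopair m h w -> (#|@comroot m h p w| <= m * (p %| absz (resp w.1 w.2)))%N.
Proof.
move=> pp hp m0 /and3P[d1 d2 c].
have [e|ne] := posnP #|@comroot m h p w|; first by rewrite e.
have /card_gt0P[s] := ne; rewrite inE => /andP[r1 r2].
rewrite (intr_Fp_eq0 pp (resp_root r1 r2)) muln1 cardE.
have nz := diffp_Fp_neq0 pp hp m0 d1.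
have := max_poly_roots nz (rs := enum (comroot w)) _ (enum_uniq _).
move=> H; rewrite -ltnS; apply: leq_trans (H _) _.
  by apply/allP => z; rewrite mem_enum inE => /andP[].
by apply: leq_trans (size_poly _ _) (size_diffp _).
Qed.

(** The sum over p is moved inside: each of the at most H ^ (4 m) coprime pairs has a nonzero
    integer [resp], divisible by boundedly many of these primes, each with at most m common
    roots. *)
Lemma sum_ncom (m : nat) : (0 < m)%N -> exists K : nat,
  forall T H : nat, (K <= T)%N -> (0 < H <= T)%N ->
  (\sum_(p < T.+1 | [&& prime p, (T < p ^ 2)%N & (H <= p)%N]) ncom m H p
     <= K * H ^ (4 * m))%N.
Proof.
(* [resp_le] gives |resp| <= A H ^ E <= T ^ (E + 1) as soon as A <= T, so at most 2 (E + 1) of the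
   primes divide it. *)
move=> m0; pose E := (m * (m + m) + m)%N; pose A := (m + m)`!%N.
exists (A + m * (2 * E.+1) + 2)%N => T H KT /andP[H0 HT].
have T1 : (1 < T)%N by apply: leq_trans KT; rewrite addn2.
have AT : (A <= T)%N by apply: leq_trans KT; rewrite -addnA leq_addr.
rewrite /ncom exchange_big /=.
apply: (@leq_trans (\sum_(w | @dcopair m H w) m * (2 * E.+1))); last first.
  rewrite sum_nat_const mulnC leq_mul //; first by rewrite addnAC leq_addl.
  apply: leq_trans (max_card _) _.
  rewrite !card_prod !card_ffun !card_ord -!expnD !addnA -[in leqRHS]mulnC leq_pexp2l //.
  by rewrite mulnC !mulSn mul0n addn0 !addnA.
apply: leq_sum => w dw.
apply: (@leq_trans (\sum_(p < T.+1 | [&& prime p, (T < p ^ 2)%N & (H <= p)%N])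
   m * (p %| absz (resp w.1 w.2)))).
  by apply: leq_sum => p /and3P[pp _ Hp]; apply: card_comroot.
rewrite -big_distrr /= leq_mul2l; apply/orP; right.
have sumE : (\sum_(p < T.+1 | [&& prime p, (T < p ^ 2)%N & (H <= p)%N])
    (p %| absz (resp w.1 w.2)))%N = size [seq p <- iota 0 T.+1 |
    [&& prime p, (T < p ^ 2)%N & (H <= p)%N] && (p %| absz (resp w.1 w.2))%N].
  rewrite size_filter -sum1_count -[iota 0 _]/(index_iota 0 T.+1) big_mkord [RHS]big_mkcondr.
  by apply: eq_bigr => p _; case: (_ %| _)%N.
have /and3P[d1 d2 c12] := dw.
have R0 : (0 < absz (resp w.1 w.2))%N by rewrite absz_gt0 resp_neq0.
rewrite sumE; apply: (size_primes_dvd T1 R0).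
- by rewrite filter_uniq // iota_uniq.
- by move=> p; rewrite mem_filter => /andP[/andP[/and3P[? ? _] ?] _].
apply: leq_trans (resp_le _ _ H0) _.
by rewrite expnS leq_mul // leq_exp2r // /E addn_gt0 m0 orbT.
Qed.

(** * Translation of tuples *)

Definition shift_tuple (m h : nat) (t : 'I_h) (x : {ffun 'I_m -> 'I_h}) :
    {ffun 'I_m -> 'I_(h + h)} :=
  [ffun i => Ordinal (leq_add (ltn_ord t) (ltnW (ltn_ord (x i))))].

Definition shift_pair (m h : nat) (t : 'I_h) (u : tpair m h) : tpair m (h + h) :=
  (shift_tuple t u.1, shift_tuple t u.2).

Lemma shift_pair_inj (m h : nat) (t : 'I_h) : injective (@shift_pair m h t).
Proof.
have inj (x y : {ffun 'I_m -> 'I_h}) : shift_tuple t x = shift_tuple t y -> x = y.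
  move=> /ffunP e; apply/ffunP => i; apply/val_inj => /=.
  by have := congr1 (@nat_of_ord _) (e i); rewrite !ffunE /= => /addnI.
by move=> [a b] [c d] [/inj -> /inj ->].
Qed.

Lemma horner_shift_pair (m h : nat) (R : comNzRingType) (t : 'I_h) (u : tpair m h) (a : R) :
  (map_poly intr (diffp (shift_pair t u))).[a] = (map_poly intr (diffp u)).[a + t%:R].
Proof.
rewrite !horner_diffp; congr (_ - _); apply: eq_bigr => i _;
  by rewrite ffunE /= natrD addrA.
Qed.

Lemma disj_shift_pair (m h : nat) (t : 'I_h) (u : tpair m h) :
  disj u -> disj (shift_pair t u).
Proof.
move=> /forallP d; apply/forallP => i; apply/forallP => j.
have /forallP/(_ j) := d i; apply: contra_neq => /(congr1 (@nat_of_ord _)).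
by rewrite !ffunE /= => /addnI/val_inj.
Qed.

Lemma copair_shift_pair (m h : nat) (t : 'I_h) (u v : tpair m h) :
  copair u v -> copair (shift_pair t u) (shift_pair t v).
Proof.
move=> c; apply/Pdiv.ClosedField.coprimepP => z.
rewrite rootE !horner_shift_pair -rootE; exact: coprimep_root c.
Qed.

Lemma dsols_root (m h p : nat) (s : 'F_p) (u : tpair m h) :
  dsols s u -> root (map_poly intr (diffp u)) s.
Proof. by case/andP => /andP[/eqP e _] _; rewrite rootE horner_diffp e subrr. Qed.

(* Translating both tuples by t and s by - t preserves everything, so that each
   pair of solutions for s is counted h times on the right. *)
Lemma ncom_ge (m h p : nat) (s : 'F_p) : prime p -> (h <= p)%N ->
  (h * #|[pred w : tpair m h * tpair m h |
     dsols s w.1 && (dsols s w.2 && copair w.1 w.2)]| <= ncom m (h + h) p)%N.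
Proof.
move=> pp hp; rewrite /ncom card_sum_pair.
set P := [pred w | _].
have -> : (h * #|P| = #|[pred z : 'I_h * (tpair m h * tpair m h) | true && P z.2]|)%N.
  by rewrite -(card_sum_pair xpredT (fun=> P)) sum_nat_const cardT size_enum_ord.
pose f (z : 'I_h * (tpair m h * tpair m h)) :=
  ((shift_pair z.1 z.2.1, shift_pair z.1 z.2.2), s - (z.1 : nat)%:R).
apply: (leq_card_inj (f := f)).
  move=> [t [u v]] [t' [u' v']] _ _ e.
  have et : t = t'.
    apply/val_inj/(natr_Fp_inj pp (leq_trans (ltn_ord t) hp) (leq_trans (ltn_ord t') hp)).
    have e5 : s - (t : nat)%:R = s - (t' : nat)%:R := congr1 snd e.
    by move/addrI/oppr_inj: e5.
  subst t'; congr (_, (_, _)).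
    exact: (@shift_pair_inj _ _ t) (congr1 (fun z => z.1.1) e).
  exact: (@shift_pair_inj _ _ t) (congr1 (fun z => z.1.2) e).
move=> [t [u v]]; rewrite !inE /= => /and3P[du dv c].
have rt (w : tpair m h) : dsols s w ->
    root (map_poly intr (diffp (shift_pair t w))) (s - (t : nat)%:R).
  by move=> dw; rewrite rootE horner_shift_pair subrK -rootE; apply: dsols_root.
have [[_ du'] [_ dv']] := (andP du, andP dv).
rewrite /dcopair /comroot /= !disj_shift_pair ?copair_shift_pair //=.
by rewrite !rt.
Qed.

(** For each solution u the solutions v are split into those coprime to u, counted by [ncom_ge], and
    the others, at most G in number. *)
Lemma dsols_energy (m h p : nat) (s : 'F_p) (G : nat) : prime p -> (h <= p)%N ->
  (forall u : tpair m h, disj u -> (#|[pred v | disj v && ~~ copair u v]| <= G)%N) ->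
  (h * #|@dsols m h p s| ^ 2 <= h * #|@dsols m h p s| * G + ncom m (h + h) p)%N.
Proof.
move=> pp hp HG; set N := #|_|.
apply: leq_trans (leq_add (leqnn _) (@ncom_ge m h p s pp hp)).
rewrite -mulnA -mulnDr leq_mul2l; apply/orP; right.
rewrite -(card_sum_pair (@dsols m h p s) (fun u => [pred v | dsols s v && copair u v])).
rewrite -mulnn -[(N * N)%N]sum_nat_const -[(N * G)%N]sum_nat_const -big_split /=.
apply: leq_sum => u /andP[_ du]; rewrite addnC.
apply: leq_trans (leq_add (leqnn _) (HG u du)).
rewrite -[N](cardID (copair u) (@dsols m h p s)) leq_add //; apply: subset_leq_card;
  apply/fintype.subsetP => v; rewrite !inE //.
by case/andP => -> /andP[_ ->].
Qed.

(** * Cancelling equal factors *)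

Definition drop_tuple (m h : nat) (i : 'I_m.+1) (x : {ffun 'I_m.+1 -> 'I_h}) :
    {ffun 'I_m -> 'I_h} := [ffun k => x (lift i k)].

Lemma drop_tuple_inj (m h : nat) (i : 'I_m.+1) (x y : {ffun 'I_m.+1 -> 'I_h}) :
  x i = y i -> drop_tuple i x = drop_tuple i y -> x = y.
Proof.
move=> e1 /ffunP e2; apply/ffunP => j; have [k ->|->//] := unliftP i j.
by have := e2 k; rewrite !ffunE.
Qed.

Lemma prod_drop_tuple (m h : nat) (R : comNzRingType) (s : R) (i : 'I_m.+1)
    (x : {ffun 'I_m.+1 -> 'I_h}) :
  \prod_j (s + (x j)%:R) = (s + (x i)%:R) * \prod_j (s + (drop_tuple i x j)%:R).
Proof.
rewrite (bigD1_ord i) //=; congr (_ * _).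
by apply: eq_bigr => j _; rewrite ffunE.
Qed.

(** A solution that is not disjoint has x_i = y_j for one of (m + 1) ^ 2 pairs (i, j). The common
    factor is nonzero and cancels, leaving one of h values and a solution with m factors on each
    side. *)
Lemma card_sols_disj (m h p : nat) (s : 'F_p) : prime p ->
  (#|@sols m.+1 h p s| <= #|@dsols m.+1 h p s| + m.+1 ^ 2 * (h * #|@sols m h p s|))%N.
Proof.
move=> pp; rewrite -(cardID (@disj m.+1 h) (sols s)) leq_add //.
pose Q (ij : 'I_m.+1 * 'I_m.+1) : pred (tpair m.+1 h) :=
  [pred u | sols s u && (u.1 ij.1 == u.2 ij.2)].
have HQ ij : (#|Q ij| <= h * #|@sols m h p s|)%N.
  have -> : (h * #|@sols m h p s| = #|[pred z : 'I_h * (tpair m h) | true && sols s z.2]|)%N.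
    by rewrite -(card_sum_pair xpredT (fun=> @sols m h p s)) sum_nat_const cardT size_enum_ord.
  case: ij => i j.
  apply: (leq_card_inj (f := fun u : tpair m.+1 h =>
    (u.1 i, (drop_tuple i u.1, drop_tuple j u.2)))).
    move=> [a b] [c d]; rewrite !inE /= => /andP[_ /eqP e1] /andP[_ /eqP e2] [] e3 e4 e5.
    by rewrite (drop_tuple_inj e3 e4) (drop_tuple_inj _ e5) // -e1 -e2.
  move=> [a b]; rewrite !inE /= => /andP[/andP[/eqP e nz] /eqP eab].
  rewrite (prod_drop_tuple _ i) mulf_eq0 negb_or in nz; case/andP: nz => n1 n2.
  apply/andP; split; last exact: n2.
  apply/eqP; apply: (mulfI n1).
  by rewrite -prod_drop_tuple e (prod_drop_tuple _ j) eab.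
apply: leq_trans (_ : size (enum {: 'I_m.+1 * 'I_m.+1}) *
    (h * #|@sols m h p s|) <= _)%N; last first.
  by rewrite -cardT card_prod card_ord mulnn.
apply: leq_trans (card_has_le _ HQ); apply: subset_leq_card.
apply/fintype.subsetP => u; rewrite !inE => /andP[/forallPn[i /forallPn[j]]].
rewrite negbK => e su; apply/hasP; exists (i, j); rewrite ?mem_enum //.
by apply/andP; split; [exact: su | exact: e].
Qed.

(** The trivial bound: once all entries but x_0 are given, the equation determines s + x_0 modulo p,
    hence x_0 because h <= p. *)
Lemma card_sols_le (m h p : nat) (s : 'F_p) : prime p -> (h <= p)%N ->
  (#|@sols m.+1 h p s| <= h ^ (m + m.+1))%N.
Proof.
move=> pp hp.
have -> : (h ^ (m + m.+1) = #|{: {ffun 'I_m -> 'I_h} * {ffun 'I_m.+1 -> 'I_h}}|)%N.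
  by rewrite card_prod !card_ffun !card_ord expnD.
rewrite [X in (_ <= X)%N]cardT -cardE.
apply: (leq_card_inj (f := fun u : tpair m.+1 h => (drop_tuple ord0 u.1, u.2))) => //.
move=> [a b] [c d]; rewrite !inE /= => /andP[/eqP e1 n1] /andP[/eqP e2 n2] [] e3 e4.
subst d; congr (_, _); apply: (drop_tuple_inj _ e3).
have := etrans e1 (esym e2); rewrite (prod_drop_tuple _ ord0) [RHS](prod_drop_tuple _ ord0) e3.
rewrite (prod_drop_tuple _ ord0) e3 mulf_eq0 negb_or in n1.
case/andP: n1 => _ n1 /(mulIf n1)/addrI/(natr_Fp_inj pp) e.
by apply/val_inj/e; rewrite (leq_trans (ltn_ord _)).
Qed.

Lemma card_dsols_mono (m h h' p : nat) (s : 'F_p) : (h <= h')%N ->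
  (#|@dsols m h p s| <= #|@dsols m h' p s|)%N.
Proof.
move=> hh; pose g (x : {ffun 'I_m -> 'I_h}) := [ffun i => widen_ord hh (x i)].
apply: (leq_card_inj (f := fun u : tpair m h => (g u.1, g u.2))).
  have gi : injective g.
    move=> x y /ffunP e; apply/ffunP => i; apply/val_inj.
    by have := congr1 (@nat_of_ord _) (e i); rewrite !ffunE.
  by move=> [a b] [c d] _ _ [/gi -> /gi ->].
move=> [a b]; rewrite !inE /= => /andP[/andP[e n] /forallP d].
have pg x : \prod_i (s + (g x i)%:R) = \prod_i (s + (x i)%:R).
  by apply: eq_bigr => i _; rewrite ffunE.
apply/andP; split; first by apply/andP; split; [rewrite /= !pg; exact: e | rewrite /= pg; exact: n].
apply/forallP => i; apply/forallP => j.
have /forallP/(_ j) := d i; apply: contra_neq => /(congr1 (@nat_of_ord _)).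
by rewrite /= !ffunE /= => e'; apply/val_inj.
Qed.

(** * Exceptional primes *)

Local Open Scope nat_scope.

Lemma count_has_le (T I : Type) (Q : I -> pred T) (s : seq T) (r : seq I) :
  (count (fun x => has (Q^~ x) r) s <= \sum_(i <- r) count (Q i) s)%N.
Proof.
elim: r => [|i r IH]; first by rewrite big_nil count_pred0.
rewrite big_cons; apply: leq_trans (leq_add (leqnn _) IH).
rewrite -count_predUI; apply: leq_trans (leq_addr _ _).
by apply: sub_count => x /=.
Qed.

Lemma count_iota (P : pred nat) (n : nat) :
  count P (iota 0 n) = (\sum_(p < n | P p) 1)%N.
Proof. by rewrite -sum1_count -[X in iota 0 X]subn0 -/(index_iota 0 n) big_mkord. Qed.

(* A prime that is not bad for h = 2^i satisfies ncom * T <= h^(4 m) * (log T)^4,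
   which forces ncom = 0 when the right-hand side is below T, so that small h need
   no separate treatment. By sum_ncom and Markov's inequality there are
   O(T / (log T)^4) bad primes for each of the O(log T) values of i. *)
Definition bad (T m i p : nat) : bool :=
  [&& prime p, (T < p ^ 2)%N, (2 ^ i <= p)%N &
      ((2 ^ i) ^ (4 * m) * trunc_log 2 T ^ 4 < ncom m (2 ^ i) p * T)%N].

(** Primes with p ^ 2 <= T are included because [sum_ncom] only covers the larger ones. *)
Definition exceptional (M T : nat) : pred nat := fun p =>
  prime p && ((p ^ 2 <= T)%N ||
   has (fun mi => bad T mi.1 mi.2 p)
     [seq (m, i) | m <- iota 1 M, i <- iota 0 (trunc_log 2 T).+1]).

Definition exceptional_fset (M T : nat) : {fset nat} :=
  [fset p in [seq p <- iota 0 T.+1 | exceptional M T p]]%fset.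

Lemma count_bad (m : nat) : (0 < m)%N -> exists K : nat,
  forall T i : nat, (K <= T)%N -> (2 ^ i <= T)%N ->
  (count (bad T m i) (iota 0 T.+1) * trunc_log 2 T ^ 4 <= K * T)%N.
Proof.
move=> m0; have [K HK] := sum_ncom m0; exists K => T i KT iT.
set X := (trunc_log 2 T ^ 4)%N; set H := (2 ^ i)%N.
have H0 : (0 < H ^ (4 * m))%N by rewrite expn_gt0 /H expn_gt0.
rewrite -(leq_pmul2r H0).
have HT : (0 < H <= T)%N by rewrite iT andbT expn_gt0.
have S := HK T H KT HT.
apply: (@leq_trans (T * (K * H ^ (4 * m)))%N); last by rewrite mulnA [(T * K)%N]mulnC.
apply: leq_trans (leq_mul (leqnn T) S).
rewrite big_distrr count_iota -mulnA big_distrl /=.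
rewrite [leqRHS](bigID (fun p : 'I_T.+1 => bad T m i p)) /=; apply: leq_trans (leq_addr _ _).
rewrite [leqRHS](eq_bigl (fun p : 'I_T.+1 => bad T m i p)); last first.
  by move=> p; rewrite /bad; case: (prime p) => //=; case: (_ < _)%N => //=; case: (_ <= _)%N.
apply: leq_sum => p /and4P[_ _ _ /ltnW]; rewrite mul1n mulnC => h.
by rewrite [leqRHS]mulnC.
Qed.

(** There are at most sqrt T small primes, and O(T / L ^ 4) bad ones for each of the O(L) pairs (m,
    i), where L = [trunc_log 2 T]. *)
Lemma card_exceptional (M : nat) : exists K : nat, forall T : nat, (K <= T)%N ->
  (#|` exceptional_fset M T| * trunc_log 2 T ^ 2 <= K * T)%N.
Proof.
have [K HK] : exists K : nat, forall m T i : nat, (0 < m <= M)%N -> (K <= T)%N -> (2 ^ i <= T)%N ->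
  (count (bad T m i) (iota 0 T.+1) * trunc_log 2 T ^ 4 <= K * T)%N.
  elim: M => [|M [K IH]]; first by exists 0%N => m T i; case: m.
  have [K' HK'] := @count_bad M.+1 isT; exists (maxn K K') => m T i /andP[m0 mM].
  rewrite geq_max => /andP[KT KT'] iT.
  move: mM; rewrite leq_eqVlt => /orP[/eqP ->|mM].
    by apply: leq_trans (HK' _ _ KT' iT) _; rewrite leq_mul2r leq_maxr orbT.
  apply: leq_trans (IH _ _ _ _ KT iT) _; first by rewrite m0.
  by rewrite leq_mul2r leq_maxl orbT.
exists (16 + 2 * (M * K) + K + 2)%N => T HT.
have KT : (K <= T)%N by apply: leq_trans HT; rewrite addnAC leq_addl.
have T1 : (1 < T)%N by apply: leq_trans HT; rewrite leq_addl.
set L := trunc_log 2 T; have L0 : (0 < L)%N by rewrite trunc_log_gt0.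
have LT : (2 ^ L <= T)%N by apply: trunc_logP => //; apply: ltnW.
have card_le : (#|` exceptional_fset M T| <= count (exceptional M T) (iota 0 T.+1))%N.
  by rewrite card_fseq (leq_trans (size_undup _)) // size_filter.
set q := count (fun p => prime p && (p ^ 2 <= T)%N) (iota 0 T.+1).
pose r := [seq (m, i) | m <- iota 1 M, i <- iota 0 L.+1].
have memr mi : mi \in r -> (0 < mi.1 <= M)%N && (mi.2 <= L)%N.
  case/allpairsP => -[m' i'] [m1 i1 ->]; move: m1 i1.
  by rewrite !mem_iota add1n ltnS add0n ltnS => -> /= ->.
set S := (\sum_(mi <- r) count (bad T mi.1 mi.2) (iota 0 T.+1))%N.
have le1 : (count (exceptional M T) (iota 0 T.+1) <= q + S)%N.
  apply: leq_trans (leq_add (leqnn q) (count_has_le _ _ _)).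
  rewrite -count_predUI; apply: leq_trans (leq_addr _ _); apply: sub_count => p /=.
  by rewrite /exceptional => /andP[-> /orP[->|->]]; rewrite ?orbT.
have Sle : (S * L ^ 4 <= M * L.+1 * (K * T))%N.
  rewrite /S big_distrl big_seq.
  apply: (@leq_trans (\sum_(mi <- r) K * T)%N).
    rewrite [leqRHS]big_seq; apply: leq_sum => mi /memr/andP[mM iL].
    by apply: HK => //; apply: leq_trans LT; rewrite leq_exp2l.
  by rewrite big_const_seq count_predT iter_addn_0 mulnC size_allpairs !size_iota.
(* The list [s] has q distinct positive entries, so if q > 0 one of them is at least q, and its
   square is at most T. *)
have qT : (q ^ 2 <= T)%N.
  rewrite /q -size_filter; set s := [seq p <- _ | _].
  have us : uniq s by rewrite filter_uniq // iota_uniq.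
  have [->|s0] := posnP (size s); first by rewrite exp0n.
  have [p ps hp] : exists2 p, p \in s & (size s <= p)%N.
    apply: contrapT => H.
    suff : (size s <= size (iota 1 (size s).-1))%N by rewrite size_iota -ltnS prednK // ltnn.
    apply: uniq_leq_size us _ => p ps; rewrite mem_iota add1n prednK //.
    have := ps; rewrite mem_filter => /andP[/andP[/prime_gt0 -> _] _] /=.
    by rewrite ltnNge; apply/negP => sp; apply: H; exists p.
  apply: (@leq_trans (p ^ 2)); first by rewrite leq_sqr.
  by move: ps; rewrite mem_filter => /andP[/andP[]].
have L4 : (L ^ 4 <= 256 * T)%N.
  apply: leq_trans (_ : L.+1 ^ 4 <= _)%N; first by rewrite leq_exp2r.
  by apply: leq_trans (exp_succ_le L (isT : 0 < 4)%N) _; rewrite leq_mul.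
have qL : (q * L ^ 2 <= 16 * T)%N.
  have e1 : ((q * L ^ 2) ^ 2 = q ^ 2 * L ^ 4)%N by rewrite expnMn -expnM.
  have e2 : ((16 * T) ^ 2 = T * (256 * T))%N by rewrite mulnCA expnMn mulnn.
  by rewrite -leq_sqr e1 e2 leq_mul.
have SL : (S * L ^ 2 <= 2 * (M * K) * T)%N.
  have L2 : (0 < L ^ 2)%N by rewrite expn_gt0 L0.
  rewrite -(leq_pmul2r L2) -mulnA -expnD; apply: leq_trans Sle _.
  have : (L.+1 <= 2 * L ^ 2)%N by nia.
  nia.
rewrite -/L; apply: (@leq_trans ((q + S) * L ^ 2)%N).
  by rewrite leq_mul2r (leq_trans card_le le1) orbT.
rewrite mulnDl; apply: leq_trans (leq_add qL SL) _.
by rewrite -mulnDl leq_mul2r -addnA leq_addr orbT.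
Qed.

Lemma exceptional_fsetP (M T p : nat) : (p <= T)%N ->
  (p \in exceptional_fset M T) = exceptional M T p.
Proof.
move=> pT; transitivity (p \in [seq p <- iota 0 T.+1 | exceptional M T p]).
  exact: in_fset.
by rewrite mem_filter mem_iota add0n ltnS pT leq0n !andbT.
Qed.

Lemma ncom_not_exceptional (M T m i p : nat) : prime p -> (p <= T)%N ->
  ~~ exceptional M T p -> (0 < m <= M)%N -> (2 ^ i <= p)%N ->
  (ncom m (2 ^ i) p * T <= (2 ^ i) ^ (4 * m) * trunc_log 2 T ^ 4)%N.
Proof.
move=> pp pT; rewrite /exceptional pp negb_or -ltnNge => /andP[Tp /hasPn nb] mM ip.
have := nb (m, i); rewrite /bad pp Tp ip -leqNgt; apply; apply/allpairsPdep.
exists m, i; split=> //; first by rewrite mem_iota add1n ltnS.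
rewrite mem_iota add0n ltnS; apply: trunc_log_max => //; exact: leq_trans pT.
Qed.

Lemma trunc_log_pow_le (T j : nat) : (0 < T)%N -> (0 < j)%N ->
  (trunc_log 2 T ^ j <= j ^ j * T)%N.
Proof.
move=> T0 j0; apply: leq_trans (_ : (trunc_log 2 T).+1 ^ j <= _)%N.
  by rewrite leq_exp2r.
by apply: leq_trans (exp_succ_le _ j0) _; rewrite leq_mul2l trunc_logP ?orbT.
Qed.

(** The alternatives tell which term of [dsols_energy] dominates. Up to constants the count is at
    most h ^ (m + 1 / k) in the first, and h ^ (2 m) / sqrt (h p) times h ^ (4 m / k) in the
    second. *)
Lemma dsols_not_exceptional (M m k : nat) : (0 < m <= M)%N -> (0 < k)%N ->
  exists C : nat, forall T p : nat, prime p -> (p <= T)%N -> ~~ exceptional M T p ->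
  forall (h : nat) (s : 'F_p), (0 < h)%N -> (4 * h <= p)%N ->
  (#|@dsols m h p s| ^ k <= C * h ^ (m * k + 1))%N \/
  ((h * #|@dsols m h p s| ^ 2 * p) ^ k <= C * h ^ (4 * m * k + 8 * m))%N.
Proof.
move=> mM k0; have [m0 _] := andP mM.
have [C1 HC1] := card_noncoprime m0 k0.
have [c8 HL8] : exists c, forall T, (0 < T)%N -> (trunc_log 2 T ^ 8 <= c * T)%N.
  by exists (8 ^ 8)%N => T T0; apply: trunc_log_pow_le.
pose Ca := (2 ^ k * (C1 * 2 ^ (m * k + 1)))%N.
pose Cb := (2 ^ k * 4 ^ (4 * m * k) * ((4 * k) ^ (4 * k) * (4 * c8 * 4 ^ (8 * m))))%N.
exists (Ca + Cb)%N => T p pp pT nex h s h0 hp.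
have T0 : (0 < T)%N by apply: leq_trans pT; apply: prime_gt0.
set a := #|_|; set L := trunc_log 2 T.
(* h is rounded up to a power H of 2 with h < H <= 2 h; translation doubles the range, so [ncom] is
   needed at 2 ^ (i + 2) <= 4 h <= p. *)
pose i := trunc_log 2 h; pose H := (2 ^ i.+1)%N.
have /andP[ih hi] : (2 ^ i <= h < H)%N by apply: trunc_log_bounds.
have H2 : (H <= 2 * h)%N by rewrite /H expnS leq_mul2l ih.
have HH : (H + H = 2 ^ i.+2)%N by rewrite [in RHS]expnS mul2n addnn.
have HH4 : (H + H <= 4 * h)%N by rewrite -[4%N]/(2 * 2)%N -mulnA mul2n -addnn leq_add.
have HHp : (2 ^ i.+2 <= p)%N by rewrite -HH (leq_trans HH4).
have Hp : (H <= p)%N by apply: leq_trans HHp; rewrite -HH leq_addr.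
pose a' := #|@dsols m H p s|.
have aa' : (a <= a')%N by apply: card_dsols_mono; apply: ltnW.
have H0 : (0 < H)%N by rewrite expn_gt0.
have [G GX Gmax] := ex_root_floor (C1 * H ^ (m * k + 1)) k0.
have := dsols_energy s pp Hp (fun u du => Gmax _ (HC1 H u H0 du)).
rewrite HH -/a'; set V := ncom _ _ _ => energy.
have VT : (V * T <= (4 * h) ^ (4 * m) * L ^ 4)%N.
  apply: leq_trans (ncom_not_exceptional pp pT nex mM HHp) _.
  by rewrite leq_mul2r leq_exp2r ?muln_gt0 // -HH HH4 orbT.
have [aG|Ga] := leqP a' (2 * G).
  left; apply: leq_trans (_ : Ca * h ^ (m * k + 1) <= _)%N; last by rewrite leq_mul2r leq_addr orbT.
  apply: (@leq_trans ((2 * G) ^ k)); first by rewrite leq_exp2r // (leq_trans aa').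
  rewrite expnMn /Ca -!mulnA leq_mul2l; apply/orP; right; apply: leq_trans GX _.
  by rewrite leq_mul2l -expnMn leq_exp2r ?addn1 // H2 orbT.
right; apply: leq_trans (_ : Cb * h ^ (4 * m * k + 8 * m) <= _)%N; last first.
  by rewrite leq_mul2r leq_addl orbT.
have e2 : (H * a' ^ 2 <= 2 * V)%N.
  move: energy Ga; rewrite -!mulnn; nia.
set X := ((4 * h) ^ (4 * m))%N in VT.
have eT : (H * a' ^ 2 * T <= 2 * (X * L ^ 4))%N.
  apply: leq_trans (leq_mul e2 (leqnn T)) _.
  by rewrite -mulnA leq_mul2l VT.
(* The count is positive here, so T is at most 2 X L ^ 4, with X a power of 4 h. Together with L ^ 8
   <= c8 T this bounds T by a multiple of h ^ (8 m), so that L ^ (4 k) = O(T) is absorbed too. *)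
have TX : (T <= 2 * (X * L ^ 4))%N.
  apply: leq_trans eT; rewrite -[leqLHS]mul1n leq_mul2r muln_gt0 H0 expn_gt0.
  by rewrite (leq_trans _ Ga) ?orbT.
have TX2 : (T <= 4 * c8 * X ^ 2)%N.
  have L8 := HL8 T T0; rewrite -/L in L8.
  rewrite -(leq_pmul2r T0).
  apply: leq_trans (leq_mul TX TX) _.
  have -> : (2 * (X * L ^ 4) * (2 * (X * L ^ 4)) = 4 * X ^ 2 * L ^ 8)%N.
    by rewrite -[8%N]/(4 + 4)%N expnD -mulnn; lia.
  apply: leq_trans (leq_mul (leqnn _) L8) _.
  by move: (X ^ 2)%N => Y; lia.
have X2 : (X ^ 2 = 4 ^ (8 * m) * h ^ (8 * m))%N.
  by rewrite /X -expnM expnMn; congr (_ ^ _ * _ ^ _)%N; lia.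
apply: (@leq_trans ((H * a' ^ 2 * T) ^ k)).
  by rewrite leq_exp2r // leq_mul // leq_mul ?(ltnW hi) // leq_exp2r.
apply: (@leq_trans ((2 * (X * L ^ 4)) ^ k)); first by rewrite leq_exp2r.
have L4k := trunc_log_pow_le T0 (_ : 0 < 4 * k)%N; rewrite -/L in L4k.
have {}L4k : (L ^ (4 * k) <= (4 * k) ^ (4 * k) * (4 * c8 * 4 ^ (8 * m) * h ^ (8 * m)))%N.
  apply: leq_trans (L4k _) _; first by rewrite muln_gt0.
  by rewrite leq_mul2l -mulnA -X2 TX2 orbT.
have Xk : (X ^ k = 4 ^ (4 * m * k) * h ^ (4 * m * k))%N.
  by rewrite /X -expnM expnMn.
have -> : ((2 * (X * L ^ 4)) ^ k = 2 ^ k * (4 ^ (4 * m * k) * h ^ (4 * m * k)) * L ^ (4 * k))%N.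
  by rewrite 2!expnMn Xk -expnM mulnA.
rewrite /Cb expnD.
set B := (4 * c8 * 4 ^ (8 * m))%N in L4k *.
have -> : (2 ^ k * 4 ^ (4 * m * k) * ((4 * k) ^ (4 * k) * B) * (h ^ (4 * m * k) * h ^ (8 * m))
  = 2 ^ k * (4 ^ (4 * m * k) * h ^ (4 * m * k)) * ((4 * k) ^ (4 * k) * (B * h ^ (8 * m))))%N.
  rewrite !mulnA; congr (_ * _)%N; rewrite -!mulnA; do 2!congr (_ * _)%N.
  by rewrite !mulnA mulnC !mulnA.
by rewrite leq_mul2l L4k orbT.
Qed.

Local Open Scope ring_scope.

(** * Solution counts with real exponents *)

Section RealBound.
Variable R : realType.

Definition Jbound (m h p : nat) : R :=
  h%:R ^+ m + h%:R ^+ (2 * m) / Num.sqrt (h%:R * p%:R).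

Lemma powR_natX_ge (h : nat) (eps : R) (k j : nat) : (0 < h)%N ->
  j%:R <= eps * k%:R -> h%:R ^+ j <= (h%:R `^ eps) ^+ k.
Proof.
move=> h0 jk; rewrite -powR_mulrn ?powR_ge0 // -powRrM -powR_mulrn ?ler0n //.
by apply: ler_powR => //; rewrite (ler_nat _ 1).
Qed.

Lemma powR_nat_ge1 (h : nat) (eps : R) : (0 < h)%N -> 0 <= eps -> 1 <= h%:R `^ eps.
Proof.
by move=> h0 e0; have := @powR_natX_ge h eps 1 0 h0; rewrite mulr1 expr0 expr1; apply.
Qed.

Lemma Jbound_ge0 m h p : 0 <= Jbound m h p.
Proof. by rewrite addr_ge0 ?exprn_ge0 // divr_ge0 ?exprn_ge0 ?sqrtr_ge0. Qed.

Lemma dsols_bound (M m : nat) (eps : R) : (0 < m <= M)%N -> 0 < eps ->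
  exists2 C : R, 0 < C & forall T p : nat, prime p -> (p <= T)%N -> ~~ exceptional M T p ->
  forall (h : nat) (s : 'F_p), (0 < h)%N -> (4 * h <= p)%N ->
  #|@dsols m h p s|%:R <= C * Jbound m h p * h%:R `^ eps.
Proof.
move=> mM e0.
(* With 8 m <= eps k the extra factors h and h ^ (8 m) are at most (h ^ eps) ^ k, hence disappear in
   h ^ eps after the k-th root. *)
pose k := (Num.truncn ((8 * m)%:R / eps)).+1.
have keps : (8 * m)%:R <= eps * k%:R.
  by rewrite mulrC -ler_pdivrMr // ltW // truncnS_gt.
have m0 : (0 < m)%N by case/andP: mM.
have k1 : 1%:R <= eps * k%:R by apply: le_trans keps; rewrite ler_nat muln_gt0.
have k0 : (0 < k)%N by [].
have [C0 HC] := dsols_not_exceptional mM k0.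
(* The summand 1 ensures C >= 1, so that C0 <= C ^ k. *)
pose C : R := C0%:R + 1.
have C1 : 1 <= C by rewrite /C lerDr.
have C0C j : C0%:R <= C ^+ j.+1.
  apply: (@le_trans _ _ C); first by rewrite /C lerDl.
  by rewrite exprS ler_peMr ?(le_trans ler01) // exprn_ege1.
exists C; first exact: lt_le_trans C1.
move=> T p pp pT nex h s h0 hp; set a := #|_|.
have h1 : 1 <= h%:R :> R by rewrite (ler_nat _ 1).
have hR0 : 0 < h%:R :> R by rewrite ltr0n.
have pR0 : 0 < p%:R :> R by rewrite ltr0n prime_gt0.
set x := h%:R `^ eps; have x0 : 0 <= x by rewrite powR_ge0.
have C00 : 0 <= C by apply: le_trans C1.
case: (HC T p pp pT nex h s h0 hp); rewrite -/a => le.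
  apply: (@le_trans _ _ (C * h%:R ^+ m * x)); last first.
    rewrite ler_wpM2r // ler_wpM2l // lerDl.
    by rewrite divr_ge0 ?exprn_ge0 ?sqrtr_ge0.
  rewrite -(ler_pXn2r k0) ?nnegrE ?mulr_ge0 ?exprn_ge0 //.
  rewrite -(ler_nat R) natrX natrM natrX in le; apply: le_trans le _.
  rewrite !exprMn -exprM exprD expr1 mulrA ler_pM ?mulr_ge0 ?exprn_ge0 //.
    by rewrite ler_wpM2r ?exprn_ge0 //; apply: C0C.
  by rewrite -[leLHS]expr1; apply: powR_natX_ge.
have le2 : h%:R * a%:R ^+ 2 * p%:R <= C * h%:R ^+ (4 * m) * x ^+ 2.
  rewrite -(ler_pXn2r k0) ?nnegrE ?mulr_ge0 ?exprn_ge0 //.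
  rewrite -(ler_nat R) natrX !natrM !natrX in le; apply: le_trans le _.
  rewrite !exprMn -!exprM exprD mulrA ler_pM ?mulr_ge0 ?exprn_ge0 //.
    by rewrite ler_wpM2r ?exprn_ge0 //; apply: C0C.
  apply: (@le_trans _ _ (x ^+ k)); first exact: powR_natX_ge.
  by rewrite ler_peMl ?exprn_ge0 // exprn_ege1 // powR_nat_ge1 // ltW.
apply: (@le_trans _ _ (C * (h%:R ^+ (2 * m) / Num.sqrt (h%:R * p%:R)) * x)); last first.
  by rewrite ler_wpM2r // ler_wpM2l // lerDr exprn_ge0.
have hp0 : 0 < h%:R * p%:R :> R by rewrite mulr_gt0.
rewrite -(ler_pXn2r (isT : 0 < 2)%N) ?nnegrE ?mulr_ge0 ?invr_ge0 ?sqrtr_ge0 ?exprn_ge0 //.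
rewrite !exprMn exprVn sqr_sqrtr ?(ltW hp0) // -exprM.
rewrite [leRHS](_ : _ = C ^+ 2 * h%:R ^+ (2 * m * 2) * x ^+ 2 / (h%:R * p%:R)); last first.
  by move: (_ ^+ (2 * m * 2)) (_ * _)^-1 => y z; ring.
rewrite ler_pdivlMr // mulrCA mulrA; apply: le_trans le2 _.
rewrite [(2 * m * 2)%N]mulnAC; do 2!(rewrite ler_wpM2r ?exprn_ge0 //).
by rewrite expr2 ler_peMl.
Qed.

(** Induction on m by [card_sols_disj]: a cancelled factor costs h, and h times [Jbound m] is at
    most [Jbound m.+1]. *)
Lemma sols_bound (M m : nat) (eps : R) : (m <= M)%N -> 0 < eps ->
  exists2 C : R, 0 < C & forall T p : nat, prime p -> (p <= T)%N -> ~~ exceptional M T p ->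
  forall (h : nat) (s : 'F_p), (0 < h <= p)%N ->
  #|@sols m h p s|%:R <= C * Jbound m h p * h%:R `^ eps.
Proof.
move=> mM e0; elim: m mM => [|m IH] mM.
  exists 1 => // T p pp pT nex h s /andP[h0 hp]; rewrite mul1r.
  apply: (@le_trans _ _ 1).
    rewrite (ler_nat _ _ 1); apply: leq_trans (max_card _) _.
    by rewrite card_prod card_ffun !card_ord.
  rewrite -[leLHS]mul1r ler_pM ?powR_nat_ge1 ?(ltW e0) //.
  by rewrite /Jbound muln0 !expr0 lerDl mul1r invr_ge0 sqrtr_ge0.
have [C2 C20 H2] := IH (ltnW mM).
have [C1 C10 H1] := @dsols_bound M m.+1 eps mM e0.
exists (C1 + (m.+1 ^ 2)%:R * C2 + 2) => [|T p pp pT nex h s /andP[h0 hp]].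
  by rewrite ltr_wpDl // addr_ge0 ?(ltW C10) // mulr_ge0 // ltW.
have h1 : 1 <= h%:R :> R by rewrite (ler_nat _ 1).
have hR0 : 0 < h%:R :> R by rewrite ltr0n.
have pR0 : 0 < p%:R :> R by rewrite ltr0n prime_gt0.
have hp0 : 0 < h%:R * p%:R :> R by rewrite mulr_gt0.
set x := h%:R `^ eps; have x1 : 1 <= x by rewrite powR_nat_ge1 // ltW.
have x0 : 0 <= x by apply: le_trans x1.
have J0 := Jbound_ge0 m.+1 h p.
have [hp4|hp4] := leqP (4 * h) p.
  have le := @card_sols_disj m h p s pp; rewrite -(ler_nat R) natrD natrM (natrM _ h) in le.
  apply: le_trans le _.
  apply: (@le_trans _ _ ((C1 + (m.+1 ^ 2)%:R * C2) * Jbound m.+1 h p * x)); last first.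
    by rewrite ler_wpM2r // ler_wpM2r // lerDl.
  rewrite 2!mulrDl; apply: lerD; first exact: (H1 T p pp pT nex h s h0 hp4).
  rewrite -!mulrA ler_wpM2l //.
  apply: (@le_trans _ _ (h%:R * (C2 * Jbound m h p * x))).
    by rewrite ler_wpM2l //; apply: (H2 T) => //; rewrite h0.
  rewrite mulrA mulrC [X in _ <= X]mulrA [X in _ <= X]mulrC ler_wpM2l //.
  rewrite mulrCA ler_wpM2l ?(ltW C20) // /Jbound mulrDr -exprS lerD2l mulrA -exprS.
  rewrite ler_wpM2r ?invr_ge0 ?sqrtr_ge0 // ler_weXn2l //; clear; lia.
(* For 4 h > p one has sqrt (h p) <= 2 h, so the trivial bound h ^ (2 m + 1) is within a factor 2 of
   the second term of [Jbound]. *)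
have le := @card_sols_le m h p s pp hp; rewrite -(ler_nat R) in le; apply: le_trans le _.
apply: (@le_trans _ _ (2 * Jbound m.+1 h p * x)); last first.
  rewrite ler_wpM2r // ler_wpM2r // lerDr addr_ge0 ?(ltW C10) //.
  by rewrite mulr_ge0 // ltW.
rewrite -[leLHS]mulr1 ler_pM //.
apply: (@le_trans _ _ (2 * (h%:R ^+ (2 * m.+1) / Num.sqrt (h%:R * p%:R)))); last first.
  by rewrite ler_wpM2l // lerDr exprn_ge0.
have s0 : 0 < Num.sqrt (h%:R * p%:R) :> R by rewrite sqrtr_gt0.
rewrite mulrA ler_pdivlMr //.
have s2 : Num.sqrt (h%:R * p%:R) <= 2 * h%:R :> R.
  rewrite -[leRHS]ger0_norm ?mulr_ge0 // -sqrtr_sqr ler_sqrt ?exprn_ge0 ?mulr_ge0 //.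
  have -> : (2 * h%:R) ^+ 2 = h%:R * (4 * h)%:R :> R by rewrite natrM; ring.
  by rewrite ler_wpM2l // ler_nat ltnW.
apply: le_trans (ler_wpM2l _ s2) _; first by rewrite ler0n.
rewrite mulrCA ler_wpM2l // natrX -exprSr ler_weXn2l //; clear; lia.
Qed.

End RealBound.

(** * Multiplicative energy *)

(** The irreducible characters of the unit group, linear because the group is abelian, are extended
    by 0. The last clause is the second orthogonality relation, c being the order of the group. *)
Lemma multiplicative_characters (F : finFieldType) :
  exists (N c : nat) (chi : 'I_N -> F -> algC), [/\ (0 < c)%N,
    forall i x y, chi i (x * y) = chi i x * chi i y, forall i, chi i 1 = 1,
    forall i, chi i 0 = 0 &
    forall x y, x != 0 -> y != 0 ->
      \sum_i chi i x * (chi i y)^* = c%:R *+ (x == y)].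
Proof.
pose G := [set: {unit F}]%G.
have abG : abelian G by apply: cyclic_abelian; apply: field_unit_group_cyclic.
have lin i : 'chi[G]_i \is a linear_char by apply/char_abelianP.
pose chi (i : Iirr G) (x : F) : algC :=
  if insub x is Some u then 'chi[G]_i u else 0.
have chiE i (u : {unit F}) : chi i (val u) = 'chi[G]_i u by rewrite /chi valK.
have unitE (x : F) : x != 0 -> {u : {unit F} | x = val u}.
  by rewrite -unitfE => ux; exists (FinRing.unit F ux).
have chi0 i : chi i 0 = 0 by rewrite /chi insubF // unitr0.
exists (Nirr G), #|G|, chi; split.
- exact: cardG_gt0.
- move=> i x y; have [->|/unitE[u ->]] := eqVneq x 0; first by rewrite mul0r chi0 mul0r.
  have [->|/unitE[v ->]] := eqVneq y 0; first by rewrite mulr0 chi0 mulr0.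
  by rewrite -FinRing.val_unitM !chiE lin_charM ?inE.
- by move=> i; rewrite -(FinRing.val_unit1 F) chiE lin_char1.
- exact: chi0.
move=> x y /unitE[u ->] /unitE[v ->].
under eq_bigr do rewrite !chiE.
rewrite second_orthogonality_relation ?inE //.
have -> : ('C_G[u] = G)%g by apply/finset.setIidPl; rewrite sub_cent1 (fintype.subsetP abG) ?inE.
congr (_ *+ (_ : bool)); apply/imsetP/eqP => [[g _ ->]|e].
  by rewrite conjgE ((centsP abG) v _ g) ?inE // mulKg.
by exists 1%g; rewrite ?inE // conjg1; apply/val_inj.
Qed.

Section Energy.
Variables (F : finFieldType) (A : finType) (m : nat).
Implicit Types (phi : 'I_m -> A -> F).

Definition esols phi : pred ({ffun 'I_m -> A} * {ffun 'I_m -> A}) :=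
  [pred w : {ffun 'I_m -> A} * {ffun 'I_m -> A} |
    (\prod_i phi i (w.1 i) == \prod_i phi i (w.2 i)) && (\prod_i phi i (w.1 i) != 0)].

Definition energy phi : nat := #|esols phi|.

(** By orthogonality, c times an energy is the sum over characters of prod_j |S_j| ^ 2. AM-GM bounds
    this product by the mean of the |S_j| ^ (2 m), which come from the energies with all functions
    equal to [phi j]. *)
Lemma energy_le_mean phi : (0 < m)%N ->
  (m * energy phi <= \sum_j energy (fun=> phi j))%N.
Proof.
move=> m0; have [N [c [chi [c0 chiM chi1 chi0 orth]]]] := multiplicative_characters F.
pose S (f : A -> F) i := \sum_a chi i (f a).
have chi_prod i (I : finType) (f : I -> F) : chi i (\prod_k f k) = \prod_k chi i (f k).
  by apply: (big_morph (chi i)).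
have key (psi : 'I_m -> A -> F) :
    \sum_i \prod_j (`|S (psi j) i| ^+ 2) = c%:R * (energy psi)%:R.
  pose P (x : {ffun 'I_m -> A}) := \prod_i psi i (x i).
  have E i : \prod_j (`|S (psi j) i| ^+ 2) =
      \sum_(x : {ffun 'I_m -> A}) \sum_(y : {ffun 'I_m -> A}) chi i (P x) * (chi i (P y))^*.
    have Q : \prod_j S (psi j) i = \sum_(x : {ffun 'I_m -> A}) chi i (P x).
      rewrite bigA_distr_bigA; apply: eq_bigr => x _.
      by rewrite chi_prod.
    rewrite prodrXl -normr_prod Q normCK rmorph_sum mulr_suml.
    by apply: eq_bigr => x _; rewrite mulr_sumr.
  under eq_bigr do rewrite E.
  rewrite exchange_big /=; under eq_bigr do rewrite exchange_big /=.
  rewrite pair_bigA /= /energy -sum1_card natr_sum mulr_sumr big_mkcond [RHS]big_mkcond /=.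
  apply: eq_bigr => -[x y] _ /=; rewrite !inE /= -/(P x) -/(P y).
  have [Px|Px] := eqVneq (P x) 0.
    by rewrite andbF Px big1 // => i _; rewrite chi0 mul0r.
  have [Py|Py] := eqVneq (P y) 0.
    by rewrite Py (negPf Px) big1 // => i _; rewrite chi0 conjC0 mulr0.
  by rewrite orth // andbT; case: (P x == P y); rewrite ?mulr1.
have mR : 0 < (m%:R : algC) by rewrite ltr0n.
have cR : 0 < (c%:R : algC) by rewrite ltr0n.
rewrite -(ler_nat algC) natrM -(ler_pM2l cR) mulrCA -key natr_sum [leRHS]mulr_sumr.
under [leRHS]eq_bigr do rewrite -key.
rewrite [leRHS]exchange_big mulr_sumr; apply: ler_sum => i _.
rewrite mulrC -ler_pdivlMr //.
(* Both sides are raised to the m-th power to match [leif_AGM], applied to the numbers |S_j| ^ (2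
   m). *)
rewrite -(ler_pXn2r m0) ?nnegrE; last 2 first.
- by apply: prodr_ge0 => j _; rewrite exprn_ge0.
- by rewrite divr_ge0 ?ler0n // sumr_ge0 // => j _; apply: prodr_ge0 => k _; rewrite exprn_ge0.
under [X in _ <= (X / _) ^+ _]eq_bigr do rewrite prodr_const card_ord.
have := leif_AGM (A := predT) (E := fun j : 'I_m => (`|S (phi j) i| ^+ 2) ^+ m).
rewrite card_ord prodrXl => /(_ _)/leif_le; apply=> j _.
by rewrite !exprn_ge0.
Qed.

End Energy.

(** * Removing the exponents *)

Section PowerEnergy.
Variables (T T' : finType) (f : T -> T').

Lemma card_fiber_pairs (rho : rel T') :
  #|[pred u : T * T | rho (f u.1) (f u.2)]| =
  (\sum_z \sum_(w | rho z w) #|[pred x | f x == z]| * #|[pred x | f x == w]|)%N.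
Proof.
rewrite -(card_sum_pair xpredT (fun x => [pred y | rho (f x) (f y)])).
rewrite (partition_big f xpredT) //=; apply: eq_bigr => z _.
rewrite (eq_bigr (fun=> #|[pred y | rho z (f y)]|)); last by move=> x /eqP ->.
rewrite sum_nat_const -big_distrr /=; congr (_ * _)%N.
rewrite -sum1_card (partition_big f (rho z)) //=; apply: eq_bigr => w zw.
rewrite -sum1_card; apply: eq_bigl => y; rewrite !inE.
by have [->|] := eqVneq (f y) w; rewrite ?zw ?andbF.
Qed.

(** With r(z) the size of the fibre over z, the inequality 2 r(z) r(w) <= r(z) ^ 2 + r(w) ^ 2
    reduces to the diagonal, and each z has at most K partners w. *)
Lemma card_rel_pairs_le (rho : rel T') (K : nat) : symmetric rho ->
  (forall z w, rho z w -> rho z z) -> (forall z, (#|rho z| <= K)%N) ->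
  (#|[pred u : T * T | rho (f u.1) (f u.2)]| <=
   K * #|[pred u : T * T | (f u.1 == f u.2) && rho (f u.1) (f u.1)]|)%N.
Proof.
move=> sym refl bd; pose r z := #|[pred x | f x == z]|.
rewrite (card_fiber_pairs rho) (card_fiber_pairs (fun z w => (z == w) && rho z z)) -/r.
rewrite -(leq_pmul2l (isT : 0 < 2)%N).
have diag : (\sum_z \sum_(w | (z == w) && rho z z) r z * r w = \sum_(z | rho z z) r z ^ 2)%N.
  rewrite [RHS]big_mkcond; apply: eq_bigr => z _.
  case: ifP => rz; last by rewrite big_pred0 // => w; rewrite andbF.
  by rewrite (big_pred1 z) // => w; rewrite andbT eq_sym.
have half : (\sum_z \sum_(w | rho z w) r z ^ 2 <= K * \sum_(z | rho z z) r z ^ 2)%N.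
  rewrite big_distrr [leqRHS]big_mkcond /=; apply: leq_sum => z _.
  rewrite sum_nat_const; case: ifP => rz; first by rewrite leq_mul2r bd orbT.
  by rewrite eq_card0 // => w; rewrite inE; apply: contraFF rz => /refl.
have half2 : (\sum_z \sum_(w | rho z w) r w ^ 2 <= K * \sum_(z | rho z z) r z ^ 2)%N.
  apply: leq_trans half; rewrite (exchange_big_dep xpredT) //=.
  apply: leq_sum => z _; rewrite (eq_bigl (rho z)) // => w; exact: sym.
rewrite diag; apply: (@leq_trans (\sum_z \sum_(w | rho z w) r z ^ 2
    + \sum_z \sum_(w | rho z w) r w ^ 2)); last by rewrite mul2n -addnn leq_add.
rewrite -big_split big_distrr; apply: leq_sum => z _ /=.
rewrite -big_split big_distrr; apply: leq_sum => w _ /=.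
exact: nat_Cauchy.
Qed.

End PowerEnergy.

(** These w are roots of X ^ n - z ^ n with n = [absz e]; for negative e both sides are inverted. *)
Lemma card_pow_eq (F : finFieldType) (e : int) (z : F) : e != 0 -> 
  (#|[pred w : F | (z ^ e == w ^ e)%R]| <= absz e)%N.
Proof.
move=> e0; have n0 : (0 < absz e)%N by rewrite absz_gt0.
set n := absz e in n0 *.
have -> : #|[pred w : F | z ^ e == w ^ e]| = #|[pred w : F | w ^+ n == z ^+ n]|.
  apply: eq_card => w; rewrite !inE /n; case: (e) => k; first by rewrite eq_sym.
  by rewrite NegzE -!exprnN (inj_eq invr_inj) abszN eq_sym.
have nz : 'X^n - (z ^+ n)%:P != 0 :> {poly F} by rewrite -size_poly_gt0 size_XnsubC.
have := max_poly_roots nz (rs := enum [pred w : F | w ^+ n == z ^+ n]) _ (enum_uniq _).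
rewrite -cardE size_XnsubC // ltnS; apply.
by apply/allP => w; rewrite mem_enum inE rootE !hornerE subr_eq0.
Qed.

(** Having equal nonzero e-th powers is a relation on residues with at most [absz e] partners for
    each value, so [card_rel_pairs_le] removes the exponent at the cost of this factor. *)
Lemma energy_pow (m h p : nat) (s : 'F_p) (e : int) : e != 0 ->
  (energy (fun (_ : 'I_m) (a : 'I_h) => ((s + (a : nat)%:R) ^ e)%R)
     <= absz e * #|@sols m h p s|)%N.
Proof.
move=> e0; pose P (x : {ffun 'I_m -> 'I_h}) := \prod_i (s + (x i)%:R).
pose rho (z w : 'F_p) := (z ^ e == w ^ e) && (z ^ e != 0).
have Pe (x : {ffun 'I_m -> 'I_h}) : \prod_(i < m) (s + (x i : nat)%:R) ^ e = P x ^ e.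
  by rewrite /P (big_morph (fun z : 'F_p => z ^ e) (fun x y => expfzMl x y e) (exp1rz _ e)).
have -> : energy (fun (_ : 'I_m) (a : 'I_h) => (s + (a : nat)%:R) ^ e) =
    #|[pred u : tpair m h | rho (P u.1) (P u.2)]|.
  by apply: eq_card => u; rewrite !inE /= !Pe.
have -> : #|@sols m h p s| = #|[pred u : tpair m h | (P u.1 == P u.2) && rho (P u.1) (P u.1)]|.
  by apply: eq_card => u; rewrite !inE /= /rho eqxx expfz_eq0 e0.
apply: card_rel_pairs_le.
- by move=> z w; rewrite /rho eq_sym; have [->|] := eqVneq.
- by move=> z w; rewrite /rho eqxx => /andP[].
move=> z; apply: leq_trans (card_pow_eq z e0); apply: subset_leq_card.
by apply/fintype.subsetP => w; rewrite !inE => /andP[].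
Qed.

(** * Bilinear and multilinear exponential sums *)

Lemma card_fiber_sq (T T' : finType) (f : T -> T') (Q : pred T') :
  #|[pred u : T * T | (f u.1 == f u.2) && Q (f u.1)]| =
  (\sum_(z | Q z) #|[pred x | f x == z]| ^ 2)%N.
Proof.
rewrite (card_fiber_pairs f (fun z w => (z == w) && Q z)) [RHS]big_mkcond.
apply: eq_bigr => z _; case: ifP => rz; last by rewrite big_pred0 // => w; rewrite andbF.
by rewrite (big_pred1 z) // => w; rewrite andbT eq_sym.
Qed.

(** Lagrange's identity: twice the difference of the sides is the sum of the squares of x_i y_j -
    x_j y_i. *)
Lemma CauchySchwarz_real (C : numFieldType) (I : finType) (x y : I -> C) :
  (forall i, x i \is Num.real) -> (forall i, y i \is Num.real) ->
  (\sum_i x i * y i) ^+ 2 <= (\sum_i x i ^+ 2) * (\sum_i y i ^+ 2).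
Proof.
move=> xr yr.
have : 0 <= \sum_i \sum_j (x i * y j - x j * y i) ^+ 2.
  apply: sumr_ge0 => i _; apply: sumr_ge0 => j _.
  by rewrite real_exprn_even_ge0 // rpredB // rpredM.
have -> : \sum_i \sum_j (x i * y j - x j * y i) ^+ 2 =
    ((\sum_i x i ^+ 2) * (\sum_i y i ^+ 2) - (\sum_i x i * y i) ^+ 2) *+ 2.
  have E i j : (x i * y j - x j * y i) ^+ 2 =
     x i ^+ 2 * y j ^+ 2 + x j ^+ 2 * y i ^+ 2 - (x i * y i) * (x j * y j) *+ 2 by ring.
  under eq_bigr do under eq_bigr do rewrite E.
  under eq_bigr do rewrite sumrB big_split /= -mulr_sumr -mulr_suml sumrMnl -mulr_sumr.
  rewrite sumrB big_split /= -mulr_suml -mulr_sumr sumrMnl -mulr_suml expr2.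
  by ring.
by rewrite pmulrn_lge0 // subr_ge0.
Qed.

Lemma CauchySchwarz_norm (C : numFieldType) (I : finType) (a b : I -> C) :
  `|\sum_i a i * b i| ^+ 2 <= (\sum_i `|a i| ^+ 2) * (\sum_i `|b i| ^+ 2).
Proof.
apply: le_trans (CauchySchwarz_real (fun i => normr_real (a i)) (fun i => normr_real (b i))).
have S0 : 0 <= \sum_i `|a i| * `|b i| by apply: sumr_ge0 => i _; rewrite mulr_ge0.
rewrite lerXn2r ?nnegrE //.
by apply: le_trans (ler_norm_sum _ _ _) _; apply: ler_sum => i _; rewrite normrM.
Qed.

(** * Additive characters modulo p *)

Section Exponential.
Variables (R : realType) (p : nat).
Hypothesis pp : prime p.
Local Open Scope complex_scope.

Definition eFp (a : 'F_p) : R[i] := ep R p (nat_of_ord a)%:Z.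

Lemma eFpD (a b : 'F_p) : eFp (a + b) = eFp a * eFp b.
Proof.
pose th (n : nat) : R := 2 * pi * n%:R / p%:R.
have pR : p%:R != 0 :> R by rewrite pnatr_eq0 -lt0n prime_gt0.
have epE (n : nat) : ep R p n%:Z = cos (th n) +i* sin (th n) by [].
have thD n k : th (n + k)%N = th n + th k by rewrite /th natrD mulrDr mulrDl.
have thp q : th (q * p)%N = (pi *+ 2) *+ q.
  by rewrite /th natrM mulrA mulfK // -mulrnA -[in RHS]mulr_natl natrM; ring.
have epmod (n : nat) : ep R p (n %% p)%N%:Z = ep R p n%:Z.
  rewrite !epE [in RHS](divn_eq n p) addnC thD thp.
  by rewrite (periodicn (@cosD2pi R)) (periodicn (@sinD2pi R)).
rewrite /eFp; have -> : nat_of_ord (a + b) = ((nat_of_ord a + nat_of_ord b) %% p)%N.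
  by congr (_ %% _)%N; apply: Fp_cast.
rewrite epmod !epE thD cosD sinD; simpc.
by congr (_ +i* _); rewrite addrC.
Qed.

Lemma eFp0 : eFp 0 = 1.
Proof. by rewrite /eFp /ep /= mulr0 mul0r cos0 sin0. Qed.

Lemma norm_eFp (a : 'F_p) : `|eFp a| = 1.
Proof. by rewrite normc_def /= cos2Dsin2 sqrtr1. Qed.

Lemma eFpN (a : 'F_p) : eFp (- a) = (eFp a)^*.
Proof.
have e1 : eFp a * (eFp a)^* = 1 by rewrite -sqr_normc norm_eFp expr1n.
have nz : eFp a != 0 by rewrite -normr_eq0 norm_eFp oner_eq0.
by apply: (mulfI nz); rewrite e1 -eFpD subrr eFp0.
Qed.

(** For p = 2 the cosine is - 1; otherwise 2 pi / p lies strictly between 0 and pi, where the sine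
    is positive. *)
Lemma eFp1_neq1 : eFp 1 != 1.
Proof.
have p2 := prime_gt1 pp.
have -> : eFp 1 = cos (2 * pi / p%:R) +i* sin (2 * pi / p%:R).
  rewrite /eFp /ep; have -> : nat_of_ord (1 : 'F_p) = 1%N.
    by rewrite -[1]/(1%:R) val_Fp_nat // modn_small.
  by rewrite mulr1.
apply/eqP => -[c1 s0].
have pR : 0 < p%:R :> R by rewrite ltr0n ltnW.
have [e2|p3] := eqVneq p 2%N.
  move: c1; rewrite e2 mulrAC divff ?pnatr_eq0 // mul1r cospi => /eqP.
  by rewrite -subr_eq0 -opprD oppr_eq0 -(natrD _ 1 1) pnatr_eq0.
have {}p3 : (2 < p)%N by rewrite ltn_neqAle eq_sym p3.
suff : 0 < sin (2 * pi / p%:R) :> R by rewrite s0 ltxx.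
apply: sin_gt0_pi; rewrite divr_gt0 ?mulr_gt0 ?pi_gt0 //=.
by rewrite ltr_pdivrMr // mulrC ltr_pM2l ?pi_gt0 // ltr_nat.
Qed.

Lemma sum_eFp (a : 'F_p) : \sum_u eFp (a * u) = p%:R *+ (a == 0).
Proof.
have [->|a0] := eqVneq a 0.
  under eq_bigr do rewrite mul0r eFp0.
  by rewrite sumr_const card_Fp.
rewrite mulr0n; set S := \sum_u _.
(* Translating u by the inverse of a multiplies the complete sum by [eFp 1], which differs from
   1. *)
have : S * eFp 1 = S.
  rewrite mulr_suml /S [RHS](reindex_inj (addrI a^-1)) /=.
  by apply: eq_bigr => u _; rewrite mulrDr mulfV // eFpD mulrC.
move/eqP; rewrite -subr_eq0 -[X in _ - X]mulr1 -mulrBr mulf_eq0 subr_eq0.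
by rewrite (negPf eFp1_neq1) orbF => /eqP.
Qed.

(** Cauchy-Schwarz in u; after expanding the square, the complete sum over u kills all terms except
    v = w, which carry the factor p. *)
Lemma bilinear_le (lambda : 'F_p) (al be : 'F_p -> R[i]) : lambda != 0 ->
  `|\sum_u al u * \sum_v be v * eFp (lambda * u * v)| ^+ 2 <=
  p%:R * (\sum_u `|al u| ^+ 2) * (\sum_v `|be v| ^+ 2).
Proof.
move=> l0; apply: le_trans (CauchySchwarz_norm _ _) _.
have A0 : 0 <= \sum_i `|al i| ^+ 2 by apply: sumr_ge0 => i _; rewrite exprn_ge0.
rewrite [p%:R * _]mulrC -mulrA ler_wpM2l //.
rewrite le_eqVlt; apply/orP; left; apply/eqP.
under eq_bigr do rewrite sqr_normc rmorph_sum mulr_suml.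
rewrite exchange_big /= mulr_sumr; apply: eq_bigr => v _.
under eq_bigr do rewrite mulr_sumr.
rewrite exchange_big /= (bigD1 v) //= [X in _ + X]big1 ?addr0.
  under eq_bigr do rewrite rmorphM mulrACA -!sqr_normc norm_eFp expr1n mulr1.
  by rewrite sumr_const card_Fp // mulr_natl.
move=> w wv; have ED a b : eFp a * (eFp b)^* = eFp (a - b) by rewrite eFpD eFpN.
transitivity (\sum_u be v * (be w)^* * eFp (lambda * (v - w) * u)).
  apply: eq_bigr => u _; rewrite rmorphM mulrACA ED.
  by congr (_ * eFp _); ring.
by rewrite -mulr_sumr sum_eFp mulf_eq0 (negPf l0) subr_eq0 eq_sym (negPf wv) mulr0.
Qed.

End Exponential.

Section Multilinear.
Variables (R : realType) (p : nat).
Hypothesis pp : prime p.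
Local Open Scope complex_scope.
Local Notation eFp := (@eFp R p).

Definition fiber_sum (X : finType) (P : X -> 'F_p) (W : X -> R[i]) (u : 'F_p) : R[i] :=
  \sum_(x | (P x != 0) && (P x == u)) W x.

(** The fibre sum vanishes at 0 and elsewhere is at most the number of x with P x = u; the squares
    of these numbers count the pairs on the right. *)
Lemma fiber_sum_le (X : finType) (P : X -> 'F_p) (W : X -> R[i]) :
  (forall x, `|W x| <= 1) ->
  \sum_u `|fiber_sum P W u| ^+ 2 <= #|[pred w | (P w.1 == P w.2) && (P w.1 != 0)]|%:R.
Proof.
move=> W1; rewrite (card_fiber_sq P (fun z => z != 0)) natr_sum [leRHS]big_mkcond /=.
apply: ler_sum => u _; rewrite /fiber_sum; case: eqVneq => [->|u0] /=.
  by rewrite big_pred0 ?normr0 ?expr0n // => x; case: eqP.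
rewrite natrX lerXn2r ?nnegrE ?ler0n //.
apply: le_trans (ler_norm_sum _ _ _) _.
apply: (@le_trans _ _ (\sum_(x | (P x != 0) && (P x == u)) 1)).
  by apply: ler_sum => x _; apply: W1.
rewrite sumr_const ler_nat; apply: subset_leq_card; apply/fintype.subsetP => x.
by rewrite !inE => /andP[].
Qed.

Lemma sum_fiber (X : finType) (P : X -> 'F_p) (W : X -> R[i]) (g : 'F_p -> R[i]) :
  \sum_(x | P x != 0) W x * g (P x) = \sum_u fiber_sum P W u * g u.
Proof.
rewrite (partition_big P xpredT) //=; apply: eq_bigr => u _.
by rewrite /fiber_sum mulr_suml; apply: eq_bigr => x /andP[_ /eqP ->].
Qed.

(** Collecting x and y by the values of [P1] and [P2] produces a bilinear form over residues, to
    which [bilinear_le] applies. *)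
Lemma two_block_le (lambda : 'F_p) (X1 X2 : finType) (P1 : X1 -> 'F_p) (P2 : X2 -> 'F_p)
    (W1 : X1 -> R[i]) (W2 : X2 -> R[i]) : lambda != 0 ->
  (forall x, `|W1 x| <= 1) -> (forall x, `|W2 x| <= 1) ->
  `|\sum_(x | P1 x != 0) \sum_(y | P2 y != 0)
      W1 x * W2 y * eFp (lambda * (P1 x * P2 y))| ^+ 2 <=
  p%:R * #|[pred w | (P1 w.1 == P1 w.2) && (P1 w.1 != 0)]|%:R
       * #|[pred w | (P2 w.1 == P2 w.2) && (P2 w.1 != 0)]|%:R.
Proof.
move=> l0 h1 h2.
have -> : \sum_(x | P1 x != 0) \sum_(y | P2 y != 0)
      W1 x * W2 y * eFp (lambda * (P1 x * P2 y)) =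
    \sum_u fiber_sum P1 W1 u * \sum_v fiber_sum P2 W2 v * eFp (lambda * u * v).
  rewrite -(sum_fiber P1 W1 (fun u => \sum_v fiber_sum P2 W2 v * eFp (lambda * u * v))).
  apply: eq_bigr => x _; rewrite -(sum_fiber P2 W2 (fun v => eFp (lambda * P1 x * v))).
  by rewrite mulr_sumr; apply: eq_bigr => y _; rewrite !mulrA.
apply: le_trans (bilinear_le pp _ _ l0) _.
apply: ler_pM; last exact: fiber_sum_le.
- by rewrite mulr_ge0 ?ler0n // sumr_ge0 // => i _; rewrite exprn_ge0.
- by apply: sumr_ge0 => i _; rewrite exprn_ge0.
by rewrite ler_wpM2l ?ler0n // fiber_sum_le.
Qed.

Definition join_tuple (A : Type) (m1 m2 : nat) (x : {ffun 'I_m1 -> A}) (y : {ffun 'I_m2 -> A}) :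
  {ffun 'I_(m1 + m2) -> A} :=
  [ffun i => match fintype.split i with inl j => x j | inr j => y j end].

Lemma join_tupleL (A : Type) (m1 m2 : nat) (x : {ffun 'I_m1 -> A}) (y : {ffun 'I_m2 -> A}) j :
  join_tuple x y (lshift m2 j) = x j.
Proof. by rewrite ffunE (unsplitK (inl j)). Qed.

Lemma join_tupleR (A : Type) (m1 m2 : nat) (x : {ffun 'I_m1 -> A}) (y : {ffun 'I_m2 -> A}) j :
  join_tuple x y (rshift m1 j) = y j.
Proof. by rewrite ffunE (unsplitK (inr j)). Qed.

Lemma sum_join_tuple (V : nmodType) (A : finType) (m1 m2 : nat)
    (G : {ffun 'I_(m1 + m2) -> A} -> V) :
  \sum_x G x = \sum_x \sum_y G (join_tuple x y).
Proof.
rewrite pair_bigA /=; apply: (reindex (fun w => join_tuple w.1 w.2)) => /=.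
exists (fun x : {ffun 'I_(m1 + m2) -> A} =>
  ([ffun j => x (lshift m2 j)], [ffun j => x (rshift m1 j)])) => [[x y] _|x _] /=.
  by congr (_, _); apply/ffunP => j; rewrite ffunE ?join_tupleL ?join_tupleR.
apply/ffunP => i; rewrite ffunE -[in RHS](splitK i).
by case: (fintype.split i) => j /=; rewrite ffunE.
Qed.

Lemma multilinear_le (lambda : 'F_p) (A : finType) (m1 m2 : nat)
    (phi : 'I_(m1 + m2) -> A -> 'F_p) (w : 'I_(m1 + m2) -> A -> R[i]) : lambda != 0 ->
  (forall i a, `|w i a| <= 1) ->
  `|\sum_(x : {ffun 'I_(m1 + m2) -> A} | \prod_i phi i (x i) != 0)
      (\prod_i w i (x i)) * eFp (lambda * \prod_i phi i (x i))| ^+ 2 <=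
  p%:R * (energy (phi \o lshift m2))%:R * (energy (phi \o @rshift m1 m2))%:R.
Proof.
move=> l0 w1.
pose P1 (x : {ffun 'I_m1 -> A}) := \prod_i phi (lshift m2 i) (x i).
pose P2 (x : {ffun 'I_m2 -> A}) := \prod_i phi (rshift m1 i) (x i).
pose W1 (x : {ffun 'I_m1 -> A}) := \prod_i w (lshift m2 i) (x i).
pose W2 (x : {ffun 'I_m2 -> A}) := \prod_i w (rshift m1 i) (x i).
have nW1 x : `|W1 x| <= 1 by rewrite normr_prod prodr_ile1 // => i _; rewrite normr_ge0 w1.
have nW2 x : `|W2 x| <= 1 by rewrite normr_prod prodr_ile1 // => i _; rewrite normr_ge0 w1.
apply: le_trans (two_block_le P1 P2 l0 nW1 nW2).
rewrite le_eqVlt; apply/orP; left; apply/eqP; congr (`|_| ^+ 2).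
rewrite big_mkcond sum_join_tuple [RHS]big_mkcond; apply: eq_bigr => x _.
have E (K : comNzRingType) (g : 'I_(m1 + m2) -> A -> K) y :
  \prod_i g i (join_tuple x y i) =
  (\prod_i g (lshift m2 i) (x i)) * (\prod_i g (rshift m1 i) (y i)).
  rewrite big_split_ord; congr (_ * _); apply: eq_bigr => i _.
    by rewrite join_tupleL.
  by rewrite join_tupleR.
rewrite [in RHS]big_mkcond; case: ifP => Px; last first.
  by apply: big1 => y _; rewrite E -/(P1 x) (eqP (negbFE Px)) mul0r eqxx.
by apply: eq_bigr => y _; rewrite !E -/(P1 x) -/(P2 y) mulf_eq0 (negPf Px).
Qed.

End Multilinear.

Local Open Scope classical_set_scope.
Local Open Scope complex_scope.

(** * The sum over a cube *)

Section Cube.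
Variables (R : realType) (p n : nat).
Hypothesis pp : prime p.

(** The cube is parametrised by the offsets from k_j + 1. As every e_j is nonzero, p divides no x_j
    exactly when the monomial is nonzero; this includes negative exponents, because the inverse of 0
    is 0 in ['F_p]. *)
Lemma Sp_tuples (lambda : int) (rho : 'I_n -> R -> R[i]) (e : 'I_n -> int)
    (k : 'I_n -> int) (h : nat) : (forall j, e j != 0) ->
  Sp p lambda rho e (cube k h) =
  \sum_(x : {ffun 'I_n -> 'I_h} |
      \prod_j (((k j + 1)%:~R + (x j : nat)%:R : 'F_p) ^ e j) != 0)
    (\prod_j rho j (k j + 1 + (x j : nat)%:Z)%:~R) *
    eFp R (lambda%:~R * \prod_j (((k j + 1)%:~R + (x j : nat)%:R : 'F_p) ^ e j)).
Proof.
move=> e0.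
pose f (x : {ffun 'I_n -> 'I_h}) : {ffun 'I_n -> int} := [ffun j => k j + 1 + (x j : nat)%:Z].
pose D := [set x : {ffun 'I_n -> 'I_h} |
   \prod_j (((k j + 1)%:~R + (x j : nat)%:R : 'F_p) ^ e j) != 0]%SET.
have finj : injective f.
  move=> x y /ffunP E; apply/ffunP => j; apply/val_inj.
  by have := E j; rewrite !ffunE => /addrI [].
have fF x j : ((f x j)%:~R : 'F_p) = (k j + 1)%:~R + (x j : nat)%:R.
  by rewrite ffunE rmorphD.
have fD x : ~~ (p%:Z %| \prod_(j < n) f x j)%Z = (x \in D).
  rewrite inE (dvdz_pcharf (pchar_Fp pp)) rmorph_prod /=.
  apply/idP/idP => /prodf_neq0 H; apply/prodf_neq0 => j _; have := H j isT; rewrite fF.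
    by move=> nz; rewrite expfz_eq0 (negPf nz) andbF.
  by apply: contraNneq => ->; rewrite expfz_eq0 e0 eqxx.
pose r := [seq f x | x <- enum D].
have ur : uniq r by rewrite map_inj_uniq ?enum_uniq.
rewrite /Sp; set B := cube k h `&` _; have -> : B = [set` r].
  apply/seteqP; split => [y [yc yd]|y /= /mapP[x]]; last first.
    rewrite mem_enum => xD ->; split; last by rewrite /= fD.
    move=> j; rewrite ffunE lerDl lez_nat /=.
    by rewrite -addrA lerD2l -[1]/(1%N%:Z) -PoszD lez_nat add1n.
  pose d j := absz (y j - (k j + 1))%R.
  have lt_h j : (d j < h)%N.
    have /andP[lo hi] := yc j.
    by rewrite -ltz_nat /d gez0_abs ?subr_ge0 // ltrBlDr addrA ltzD1 addrC.
  have fy : f [ffun j => Ordinal (lt_h j)] = y.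
    apply/ffunP => j; rewrite !ffunE /=; have /andP[lo _] := yc j.
    by rewrite /d gez0_abs ?subr_ge0 // addrC subrK.
  by apply/mapP; exists [ffun j => Ordinal (lt_h j)]; rewrite ?mem_enum -?fD fy.
rewrite -fsbig_seq // big_map big_enum /=.
apply: eq_big => [x|x _]; first by rewrite inE.
congr (_ * _); first by apply: eq_bigr => j _; rewrite ffunE.
rewrite /eFp /monomial_mod; congr (ep R p (nat_of_ord (_ * _))%:Z).
by apply: eq_bigr => j _; rewrite fF.
Qed.

End Cube.

(** * Assembling the bound *)

Lemma energy_bound (R : realType) (M m : nat) (eps : R) : (0 < m <= M)%N -> 0 < eps ->
  exists2 C : R, 0 < C & forall T p : nat, prime p -> (p <= T)%N -> ~~ exceptional M T p ->
  forall (h : nat) (s : 'I_m -> 'F_p) (e : 'I_m -> int), (0 < h <= p)%N ->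
  (forall j, e j != 0) ->
  (energy (fun j (a : 'I_h) => (s j + (a : nat)%:R) ^ e j))%:R <=
    C * (\sum_j absz (e j))%:R * (Jbound R m h p * h%:R `^ eps).
Proof.
move=> /andP[m0 mM] e0; have [C C0 HC] := sols_bound mM e0; exists C => //.
move=> T p pp pT nex h s e hp ne; set E := energy _.
have le : (E <= \sum_j absz (e j) * #|@sols m h p (s j)|)%N.
  apply: (@leq_trans (m * E)); first by rewrite leq_pmull.
  by apply: leq_trans (energy_le_mean _ m0) _; apply: leq_sum => j _; apply: energy_pow.
rewrite -(ler_nat R) in le; apply: le_trans le _.
rewrite !natr_sum mulr_sumr mulr_suml; apply: ler_sum => j _.
rewrite natrM mulrAC [leRHS]mulrC ler_wpM2l // mulrA.
exact: (HC T).
Qed.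

(** Of the four terms of the product, two are the squares of the outer summands on the right. Of the
    cross terms, the one with m2 is the square of the middle summand and dominates the one with m1,
    whence the factor 2. *)
Lemma Jbound_prod (R : realType) (m1 m2 h p : nat) : (m1 <= m2)%N -> (0 < h)%N -> (0 < p)%N ->
  p%:R * (Jbound R m1 h p * Jbound R m2 h p) <=
  2 * (h%:R `^ ((m1 + m2)%:R / 2) * p%:R `^ (1 / 2)
       + h%:R `^ ((m1 + m2)%:R / 2 + m2%:R / 2 - 1 / 4) * p%:R `^ (1 / 4)
       + h%:R `^ ((m1 + m2)%:R - 1 / 2)) ^+ 2.
Proof.
move=> m12 h0 p0; set n := (m1 + m2)%N.
have HR : 0 < h%:R :> R by rewrite ltr0n.
have PR : 0 < p%:R :> R by rewrite ltr0n.
set A1 := _ * p%:R `^ (1 / 2); set A2 := _ * p%:R `^ (1 / 4); set A3 := h%:R `^ (_ - 1 / 2).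
(* In terms of these square roots all exponents become integers. *)
pose a : R := Num.sqrt h%:R; pose b : R := Num.sqrt p%:R.
have a0 : 0 < a by rewrite sqrtr_gt0.
have b0 : 0 < b by rewrite sqrtr_gt0.
have a2 : h%:R = a ^+ 2 by rewrite sqr_sqrtr // ltW.
have b2 : p%:R = b ^+ 2 by rewrite sqr_sqrtr // ltW.
have sq (x y : R) : (x `^ y) ^+ 2 = x `^ (y * 2).
  by rewrite -powR_mulrn ?powR_ge0 // -powRrM.
have half (x : R) : 0 <= x -> x `^ (1 / 2) = Num.sqrt x by rewrite mul1r; apply: powR12_sqrt.
have hB (x y : R) : h%:R `^ (x - y) = h%:R `^ x / h%:R `^ y.
  by rewrite powRB // (gt_eqF HR) implybT.
have A1E : A1 ^+ 2 = a ^+ (2 * n) * b ^+ 2.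
  rewrite exprMn !sq divfK // mul1r mulVf // powRr1 ?ltW // powR_mulrn ?ltW //.
  by rewrite b2 a2 -exprM.
have A2E : A2 ^+ 2 = a ^+ (2 * (n + m2)) * b / a.
  rewrite exprMn !sq.
  have -> : 1 / 4 * 2 = 1 / 2 :> R by field.
  have -> : (n%:R / 2 + m2%:R / 2 - 1 / 4) * 2 = (n + m2)%:R - 1 / 2 :> R.
    by rewrite natrD; field.
  rewrite hB !half ?ltW // powR_mulrn ?ltW // -/a -/b a2 -exprM.
  by rewrite mulrAC.
have A3E : A3 ^+ 2 = a ^+ (2 * (2 * n)) / a ^+ 2.
  rewrite sq.
  have -> : (n%:R - 1 / 2) * 2 = (2 * n)%:R - 1 :> R by rewrite natrM; field.
  by rewrite hB powRr1 ?ltW // powR_mulrn ?ltW // {1}a2 -exprM -a2.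
have sqM : Num.sqrt (h%:R * p%:R) = a * b :> R by rewrite sqrtrM // ltW.
have JE : p%:R * (Jbound R m1 h p * Jbound R m2 h p) =
    A1 ^+ 2 + A2 ^+ 2 + a ^+ (2 * (n + m1)) * b / a + A3 ^+ 2.
  (* Every power of a is written through a ^ m1 and a ^ m2, so that [field] sees a rational
     identity. *)
  have ex (i j k : nat) : (k = i * m1 + j * m2)%N -> a ^+ k = (a ^+ m1) ^+ i * (a ^+ m2) ^+ j.
    by move=> ->; rewrite exprD -!exprM [(m1 * i)%N]mulnC [(m2 * j)%N]mulnC.
  rewrite /Jbound sqM A1E A2E A3E b2 a2 -![(a ^+ 2) ^+ _]exprM /n.
  rewrite (ex 2 0 (2 * m1))%N; last by clear; lia.
  rewrite (ex 0 2 (2 * m2))%N; last by clear; lia.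
  rewrite (ex 4 0 (2 * (2 * m1)))%N; last by clear; lia.
  rewrite (ex 0 4 (2 * (2 * m2)))%N; last by clear; lia.
  rewrite (ex 2 2 (2 * (m1 + m2)))%N; last by clear; lia.
  rewrite (ex 2 4 (2 * (m1 + m2 + m2)))%N; last by clear; lia.
  rewrite (ex 4 2 (2 * (m1 + m2 + m1)))%N; last by clear; lia.
  rewrite (ex 4 4 (2 * (2 * (m1 + m2))))%N; last by clear; lia.
  move: (a ^+ m1) (a ^+ m2) => u v.
  by field; rewrite !gt_eqF.
have A2' : a ^+ (2 * (n + m1)) * b / a <= A2 ^+ 2.
  rewrite A2E ler_wpM2r ?invr_ge0 ?(ltW a0) // ler_wpM2r ?(ltW b0) //.
  rewrite !exprM -a2 ler_weXn2l ?(ler_nat _ 1) // leq_add2l //.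
rewrite JE.
have n1 : 0 <= A1 by rewrite mulr_ge0 ?powR_ge0.
have n2 : 0 <= A2 by rewrite mulr_ge0 ?powR_ge0.
have n3 : 0 <= A3 by rewrite powR_ge0.
nra.
Qed.

Lemma Sp_bound (R : realType) (n m1 m2 : nat) (e : 'I_n -> int) (eps : R) :
  n = (m1 + m2)%N -> (0 < m1)%N -> (m1 <= m2)%N -> (forall j, e j != 0) -> 0 < eps ->
  exists2 C : R, 0 < C &
  forall T p : nat, prime p -> (p <= T)%N -> ~~ exceptional n T p ->
  forall h : nat, (0 < h <= p)%N ->
  forall (k : 'I_n -> int) (rho : 'I_n -> R -> R[i]),
  (forall (j : 'I_n) (x : R), `|rho j x| <= 1) ->
  forall lambda : int, coprimez lambda p%:Z ->
  `|Sp p lambda rho e (cube k h)| <=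
          (C * (h%:R `^ (n%:R / 2) * p%:R `^ (1 / 2)
                + h%:R `^ (n%:R / 2 + m2%:R / 2 - 1 / 4) * p%:R `^ (1 / 4)
                + h%:R `^ (n%:R - 1 / 2))
             * h%:R `^ eps)%:C.
Proof.
move=> En m10 m12; subst n => e0 eps0.
have m20 : (0 < m2)%N by apply: leq_trans m12.
have r1 : (0 < m1 <= m1 + m2)%N by rewrite m10 leq_addr.
have r2 : (0 < m2 <= m1 + m2)%N by rewrite m20 leq_addl.
have [C1 C10 H1] := energy_bound r1 eps0.
have [C2 C20 H2] := energy_bound r2 eps0.
pose K : R := C1 * (\sum_j absz (e (lshift m2 j)))%:R *
              (C2 * (\sum_j absz (e (rshift m1 j)))%:R).
have K0 : 0 <= K by apply: mulr_ge0; apply: mulr_ge0; rewrite ?ler0n ?(ltW C10) ?(ltW C20).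
(* The bound reached is r ^ 2 <= 2 K A ^ 2 (h ^ eps) ^ 2, and 2 K <= (2 K + 1) ^ 2. Each block
   supplies one factor h ^ eps, so a single one remains after the square root. *)
exists (2 * K + 1); first by apply: ltr_wpDl => //; apply: mulr_ge0.
move=> T p pp pT nex h hp k rho hrho lambda cop.
have [h0 _] := andP hp.
have p0 := prime_gt0 pp.
have l0 : (lambda%:~R : 'F_p) != 0.
  rewrite -(dvdz_pcharf (pchar_Fp pp)) dvdzE /= -prime_coprime // coprime_sym.
  by rewrite coprimezE in cop.
pose s j : 'F_p := (k j + 1)%:~R.
pose phi j (a : 'I_h) : 'F_p := (s j + (a : nat)%:R) ^ e j.
pose w j (a : 'I_h) : R[i] := rho j (k j + 1 + (a : nat)%:Z)%:~R.
have := @multilinear_le R p pp lambda%:~R 'I_h m1 m2 phi w l0 (fun j a => hrho j _).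
rewrite (Sp_tuples pp lambda rho k h e0) -/phi; set S := \sum_(x | _) _.
set E1 := energy _; set E2 := energy _ => le.
have e1 := H1 T p pp pT nex h (fun j => s (lshift m2 j)) (fun j => e (lshift m2 j))
  hp (fun j => e0 _).
have e2 := H2 T p pp pT nex h (fun j => s (rshift m1 j)) (fun j => e (rshift m1 j))
  hp (fun j => e0 _).
rewrite -/E1 in e1; rewrite -/E2 in e2.
(* Norms in [R[i]] are themselves complex; r is the real value, which moves the inequality to R. *)
have [r r0 rE] : exists2 r : R, 0 <= r & `|S| = r%:C.
  by rewrite normc_def; eexists; last reflexivity; rewrite sqrtr_ge0.
rewrite rE in le *; rewrite lecR.
set A := (_ + _ + _); set x := h%:R `^ eps.
have {}le : r ^+ 2 <= p%:R * E1%:R * E2%:R.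
  by rewrite -lecR; move: le; rewrite !rmorphM /= !rmorph_nat.
have A0 : 0 <= A by rewrite !addr_ge0 ?mulr_ge0 ?powR_ge0.
have x0 : 0 <= x by rewrite powR_ge0.
rewrite -(ler_pXn2r (isT : 0 < 2)%N) ?nnegrE ?mulr_ge0 ?addr_ge0 ?mulr_ge0 //.
apply: le_trans le _; rewrite -mulrA.
have J1 := Jbound_ge0 R m1 h p; have J2 := Jbound_ge0 R m2 h p.
apply: (@le_trans _ _ (p%:R * (C1 * (\sum_j absz (e (lshift m2 j)))%:R * (Jbound R m1 h p * x) *
   (C2 * (\sum_j absz (e (rshift m1 j)))%:R * (Jbound R m2 h p * x))))).
  by rewrite ler_wpM2l ?ler0n // ler_pM ?ler0n.
apply: (@le_trans _ _ (K * (p%:R * (Jbound R m1 h p * Jbound R m2 h p)) * x ^+ 2)).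
  by rewrite le_eqVlt; apply/orP; left; apply/eqP; rewrite /K; ring.
apply: (@le_trans _ _ (K * (2 * A ^+ 2) * x ^+ 2)).
  by rewrite ler_wpM2r ?exprn_ge0 // ler_wpM2l // Jbound_prod.
rewrite !exprMn ler_wpM2r ?exprn_ge0 // mulrA ler_wpM2r ?exprn_ge0 //.
- nra.
- exact: ltW.
- exact: ltW.
Qed.

(** * Density of the exceptional primes *)

Lemma card_exceptional_littleo (R : realType) (M : nat) :
  (fun T : nat => (#|` exceptional_fset M T|)%:R : R^o)
    =o_\oo (fun T : nat => (T%:R / ln T%:R : R^o)).
Proof.
have [K HK] := card_exceptional M.
apply/eqoP => d d0.
(* [card_exceptional] and ln T <= 2 L bound the ratio by 2 K / L, and L >= N makes this at most
   d. *)
pose N := (Num.truncn ((2 * K)%:R / d)).+1.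
near=> T.
have KT : (K <= T)%N by near: T; exact: nbhs_infty_ge.
have NT : (2 ^ N <= T)%N by near: T; exact: nbhs_infty_ge.
have T0 : (0 < T)%N by apply: leq_trans NT; rewrite expn_gt0.
have T1 : (1 < T)%N by apply: leq_trans NT; rewrite -[X in (X < _)%N](expn0 2) ltn_exp2l.
set L := trunc_log 2 T.
have NL : (N <= L)%N by apply: trunc_log_max.
have L0 : 0 < L%:R :> R by rewrite ltr0n (leq_trans _ NL).
have lnT : ln T%:R <= 2 * L%:R :> R.
  have TL : (T < 2 ^ L.+1)%N by apply: trunc_log_ltn.
  apply: (@le_trans _ _ (ln ((2 : R) ^+ L.+1))).
    rewrite ler_ln ?posrE ?exprn_gt0 ?ltr0n // -natrX ler_nat; exact: ltnW.
  rewrite lnXn // -[X in X <= _]mulr_natl.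
  apply: (@le_trans _ _ (L.+1%:R * 1)).
    (* ln 2 <= 1 because 1 + 1 <= exp 1. *)
    rewrite ler_wpM2l // -ler_expR lnK ?posrE //.
    have := @expR_ge1Dx R 1; rewrite -(natrD _ 1 1); exact.
  rewrite mulr1 -natrM ler_nat; have : (0 < L)%N by apply: leq_trans NL.
  by clear; lia.
have ln0 : 0 < ln T%:R :> R by rewrite ln_gt0 // (ltr_nat _ 1).
have h := HK T KT; rewrite -/L -(ler_nat R) natrM natrX natrM in h.
have TR : 0 < T%:R :> R by rewrite ltr0n.
rewrite !ger0_norm ?divr_ge0 ?ler0n ?(ltW ln0) //.
rewrite mulrA ler_pdivlMr //.
apply: (@le_trans _ _ (#|` exceptional_fset M T|%:R * (2 * L%:R))).
  by rewrite ler_wpM2l.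
rewrite -(ler_pM2r L0).
apply: (@le_trans _ _ (2 * (K%:R * T%:R))).
  have -> : #|` exceptional_fset M T|%:R * (2 * L%:R) * L%:R =
    2 * (#|` exceptional_fset M T|%:R * L%:R ^+ 2) :> R by ring.
  by rewrite ler_wpM2l.
have -> : 2 * (K%:R * T%:R) = T%:R * (2 * K)%:R :> R by rewrite natrM; ring.
have -> : d * T%:R * L%:R = T%:R * (L%:R * d) by ring.
rewrite ler_wpM2l ?(ltW TR) // -ler_pdivrMr //.
apply: (@le_trans _ _ N%:R); last by rewrite ler_nat.
by rewrite ltW // truncnS_gt.
Unshelve. all: by end_near. Qed.

Theorem theorem8 (R : realType) (n : nat) (hn : (2 <= n)%N) :
  exists E : nat -> {fset nat},
    [/\ forall T : nat, (2 <= T)%N ->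
          forall p : nat, p \in E T -> prime p /\ (p <= T)%N,
        (fun T : nat => (#|` E T|)%:R : R^o)
          =o_\oo (fun T : nat => (T%:R / ln T%:R : R^o)) &
        forall e : 'I_n -> int, \prod_(j < n) e j != 0 ->
        forall eps : R, 0 < eps ->
        exists2 C : R, 0 < C &
        \forall T \near \oo,
        forall p : nat, prime p -> (p <= T)%N -> p \notin E T ->
        forall h : nat, (3 <= h <= p)%N ->
        forall (k : 'I_n -> int) (rho : 'I_n -> R -> R[i]),
        (forall (j : 'I_n) (x : R), `|rho j x| <= 1) ->
        forall lambda : int, coprimez lambda p%:Z ->
        `|Sp p lambda rho e (cube k h)| <=
          (C * (h%:R `^ (n%:R / 2) * p%:R `^ (1 / 2)
                + h%:R `^ (n%:R / 2 + (uphalf n)%:R / 2 - 1 / 4)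
                  * p%:R `^ (1 / 4)
                + h%:R `^ (n%:R - 1 / 2))
             * h%:R `^ eps)%:C].
Proof.
(* Both blocks have at most n variables, so M = n covers them for every exponent vector. *)
exists (exceptional_fset n); split.
- move=> T _ p pE; have [pT|Tp] := leqP p T.
    by move: pE; rewrite exceptional_fsetP // => /andP[].
  have : p \in [seq p <- iota 0 T.+1 | exceptional n T p] by rewrite -(in_fset imfset_key).
  by rewrite mem_filter mem_iota add0n ltnS [(p <= T)%N]leqNgt Tp !andbF.
- exact: card_exceptional_littleo.
move=> e /prodf_neq0 e0 eps eps0.
(* As n >= 2 neither block is empty; the larger one, of size [uphalf n], comes second and yields the
   ceiling in the exponent. *)
have n1 : (0 < n./2)%N by rewrite half_gt0.
have n12 : (n./2 <= uphalf n)%N by rewrite uphalf_half leq_addl.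
have En : n = (n./2 + uphalf n)%N by rewrite uphalf_half addnCA addnn odd_double_half.
have [C C0 HC] := Sp_bound En n1 n12 (fun j => e0 j isT) eps0.
exists C => //; apply: nearW => T p pp pT pE h /andP[h3 hp] k rho hrho lambda cop.
rewrite exceptional_fsetP // in pE.
by apply: (HC T p pp pT pE h _ k rho hrho lambda cop); rewrite hp (ltn_trans _ h3).
Qed.
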